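(* Let $0<\delta<2$, let $a$ be real with $\delta\log Q > 28a\geq 0$, and let $A$ satisfy $28a/(\delta\log Q) <A<14/\delta$. Let $f(Q)$ be a function of $Q$ which tends to infinity as $Q\to\infty$ and satisfies $(\log Q)^{14a/(\delta\log Q)} =o(f(Q))$ and $f(Q)=o((\log Q)^{A/2})$ as $Q\to\infty$. Then for almost all primitive characters $\chi$ mod $q\leq Q$ we have \begin{align*} \log L(1-a/\log Q, \chi) = \sum_{p\leq (\log Q)^A}\frac{\chi(p)}{p^{1-a/\log Q}} +C(1-a/\log Q,\chi) +O_{\delta}\left( \frac{e^a\log\log Q}{\log Q}+\frac{f(Q)}{(\log Q)^{A/2}}\right). \end{align*} Especially (the case $a=0$), for almost all primitive characters $\chi$ mod $q\leq Q$ we have \begin{align*} \log L(1,\chi)= \sum_{p\leq (\log Q)^A}\frac{\chi(p)}{p} +C(1,\chi) +O_{\delta}\left( \frac{e^a\log\log Q}{\log Q}+\frac{f(Q)}{(\log Q)^{A/2}}\right), \end{align*} where here $f(Q)$ stands for any function of $Q$ which tends to infinity and satisfies $f(Q)=o((\log Q)^{A/2})$ as $Q\to\infty$.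
   Context: $Q\geq 16$ is large; $p$ denotes primes; $L(s,\chi)$ is the Dirichlet $L$-function attached to a primitive Dirichlet character $\chi$ mod $q$ with $q\leq Q$. For $\alpha>1/2$, $C(\alpha,\chi)=\sum_p\sum_{\ell=2}^{\infty}\frac{\chi(p^{\ell})}{\ell p^{\ell\alpha}}$. ''Almost all'' means all but $o(Q^2)$ of the primitive characters with conductor $q\leq Q$ (whose total number is $\frac{18}{\pi^4}Q^2+O(Q(\log Q)^2)$). The implied constant in $O_\delta$ depends only on $\delta$. *)

(* Defs.v *)
From HB Require Import structures.
From mathcomp Require Import all_boot all_order all_algebra.
From mathcomp Require Import all_classical all_reals all_analysis.
From mathcomp Require Import complex.

Set Implicit Arguments.
Unset Strict Implicit.
Unset Printing Implicit Defensive.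

Import Order.TTheory GRing.Theory Num.Theory.
Import numFieldNormedType.Exports.

Local Open Scope classical_set_scope.
Local Open Scope complex_scope.
Local Open Scope ring_scope.

(* Enables the Landau notation f =o_+oo g. *)
Canonical pinfty_filter_on (R : realType) := FilterType (pinfty_nbhs R) _.

(* Dirichlet characters are taken as functions on the natural numbers, which
   determine the corresponding functions on the integers by periodicity. *)
Definition dirichlet_character (R : realType) (q : nat) (chi : nat -> R[i]) :
    Prop :=
  [/\ (0 < q)%N,
      chi 1%N = 1,
      forall m n, chi (m * n)%N = chi m * chi n,
      forall n, chi (n + q)%N = chi n
    & forall n, (chi n != 0) = coprime n q].

Definition induced_from (R : realType) (q d : nat) (chi : nat -> R[i]) : Prop :=
  exists psi : nat -> R[i],
    dirichlet_character d psi /\ (forall n, coprime n q -> chi n = psi n).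

(* Equivalently: chi has conductor q.  The constant character 1 is primitive
   modulo 1. *)
Definition primitive_character (R : realType) (q : nat) (chi : nat -> R[i]) :
    Prop :=
  dirichlet_character q chi /\
  (forall d, (d %| q)%N -> (d < q)%N -> ~ induced_from q d chi).

Definition cexp (R : realType) (z : R[i]) : R[i] :=
  (expR (complex.Re z))%:C * (cos (complex.Im z) +i* sin (complex.Im z)).

(* [dirichlet_L q chi s l]: the value at the real point s > 0 of the
   (analytically continued) function L(s, chi) is l.  When chi is nonprincipal
   its mean value over a period is 0 and L(s, chi) is the sum of its Dirichlet
   series, which converges for s > 0.  For principal chi the second term
   provides the continuation to s > 0, s <> 1; at the pole s = 1 there is no
   value l, because x / 0 = 0 and the harmonic sums diverge. *)
Definition dirichlet_L (R : realType) (q : nat) (chi : nat -> R[i]) (s : R)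
    (l : R[i]) : Prop :=
  (\sum_(1 <= n < N.+1) chi n / (n%:R `^ s)%:C
     - (\sum_(n < q) chi n) / q%:R * (N%:R `^ (1 - s) / (1 - s))%:C)
    @[N --> \oo] --> (l : R[i]^o).

(* [log_L q chi s w]: w is log L(s, chi), for the branch of the logarithm
   obtained by continuous variation along the real axis from +oo, where
   log L(s, chi) tends to 0 (for s > 1 this is the logarithm given by the Euler
   product).  It is undefined when L(., chi) has a zero or a pole
   on [s, +oo[. *)
Definition log_L (R : realType) (q : nat) (chi : nat -> R[i]) (s : R)
    (w : R[i]) : Prop :=
  exists g : R -> R[i]^o,
    [/\ {within `[s, +oo[, continuous g},
        forall x, s <= x -> dirichlet_L q chi x (cexp (g x)),
        g x @[x --> +oo] --> (0 : R[i]^o)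
      & g s = w].

(* The sum over primes p and exponents l >= 2 of chi(p^l) / (l p^(l alpha)),
   absolutely convergent for alpha > 1/2. *)
Definition prime_power_sum (R : realType) (chi : nat -> R[i]) (alpha : R) :
    R[i] :=
  \big[+%R/0]_(0 <= p <oo | prime p)
    \big[+%R/0]_(2 <= l <oo)
      (chi (p ^ l)%N / (l%:R * p%:R `^ (l%:R * alpha))%:C : R[i]^o).

Definition prime_sum (R : realType) (chi : nat -> R[i]) (s y : R) : R[i] :=
  \sum_(0 <= p < (Num.truncn y).+1 | prime p) chi p / (p%:R `^ s)%:C.

(* log L(s, chi) is defined and is approximated with an error at most B by the
   sum over primes p <= y plus the contribution of the higher prime powers. *)
Definition log_L_approx (R : realType) (q : nat) (chi : nat -> R[i])
    (s y B : R) : Prop :=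
  exists w : R[i], log_L q chi s w /\
    `|w - (prime_sum chi s y + prime_power_sum chi s)| <= B%:C.

(* For all but o(Q^2) of the primitive characters chi of conductor q <= Q, the
   property P Q q chi holds. *)
Definition almost_all_primitive (R : realType)
    (P : R -> nat -> (nat -> R[i]) -> Prop) : Prop :=
  forall eps : R, 0 < eps -> \forall Q \near +oo,
    exists2 N : nat, N%:R <= eps * Q ^+ 2 &
      ([set x : nat * (nat -> R[i]) |
        [/\ x.1%:R <= Q, primitive_character x.1 x.2 & ~ P Q x.1 x.2]]
      #<= `I_N)%card.

(* Main.v *)
Require Import Defs.
From HB Require Import structures.
From mathcomp Require Import all_boot all_order all_algebra.
From mathcomp Require Import all_classical all_reals all_analysis.
From mathcomp Require Import complex.
From mathcomp Require Import zify ring lra.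
From mathcomp Require Import finmap.

(* For 0 < s <= 1 and Y = floor((log Q)^A), the product of L(x, chi) with the
   inverse Euler factors at the primes p <= Y is 1 + E(x), where E(x) is the sum
   of chi(n) n^-x over the n > 1 without prime factor <= Y.  If |E(x)| <= 1/2 for
   all x >= s, then L(., chi) does not vanish on [s, +oo[, and log L(s, chi)
   differs from the logarithm of the short Euler product by O(|E(s)|).  So no
   zero-density estimate is needed: it suffices to bound sup_(x >= s) |E(x)| on
   average over chi.
   - Cutting E(x) at n = K, of size Q^4, costs a negative power of Q for every
     nonprincipal chi: |sum_(n > u) chi(n) n^-x| <= 2q (u+1)^-x, and the factors
     1 - chi(p)/p^x are multiplied in one prime at a time.  The loss is
     exp(O(Y^(delta/16))) = exp(O((log Q)^(7/8))), as A < 14/delta.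
   - Partial summation bounds the remaining finite sum, for all x >= s at once, by
     a combination of its tails at x = s.  The first moment of the tails over the
     characters mod q follows from Bessel's inequality on blocks of q consecutive
     integers, with no large sieve, because s >= 13/14.  The diagonal terms give
     the main contribution Y^(1/2 - s), and Markov's inequality concludes. *)

Set Implicit Arguments.
Unset Strict Implicit.
Unset Printing Implicit Defensive.

Import Order.TTheory GRing.Theory Num.Theory.
Import numFieldNormedType.Exports.

Local Open Scope classical_set_scope.
Local Open Scope complex_scope.
Local Open Scope ring_scope.

(** * Complex modulus and limits *)


(** All x >= s are needed at once because the branch of log L is fixed by continuity from +oo. That
    branch is -clog(-E(x)) plus the sum of clog(chi(p)/p^x) over p <= Y, where clog z = -log(1 - z):
    its exponential is L(x, chi), and it is continuous and tends to 0 at +oo once |E| <= 1/2 on the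
    half-line. The truncation uses a saving exponent th much smaller than x. With the full exponent
    x every prime p <= Y would cost a factor 2, and 2^pi(Y) exceeds every power of Q for a fixed A >
    1. With th = delta/16 - a/log Q the cost is 1 + p^(th - x), where x - th >= 1 - delta/16. The
    function f is the room for Markov's inequality. Since A < 14/delta, the mean Y^(1/2 - s) is, up
    to a constant, at most (log Q)^(14a/(delta log Q)) (log Q)^(-A/2), which is o(f(Q) (log
    Q)^(-A/2)). With the threshold f(Q) (log Q)^(-A/2), each modulus thus has o(Q) exceptional
    characters. *)

Section ComplexModulus.
Variable R : realType.
Implicit Types z w : R[i].

(** The norm of [R[i]] takes its values in [R[i]], whose order is only partial; the estimates are
    made with this real-valued copy. *)
Definition cabs z : R := complex.Re `|z|.

Lemma cabsE z : `|z| = (cabs z)%:C.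
Proof. by rewrite /cabs RRe_real ?normr_real. Qed.

Lemma cabs_le z (b : R) : (`|z| <= b%:C) = (cabs z <= b).
Proof. by rewrite cabsE lecR. Qed.

Lemma cabs_ge0 z : 0 <= cabs z.
Proof. by rewrite -lecR -cabsE normr_ge0. Qed.

Lemma cabsM z w : cabs (z * w) = cabs z * cabs w.
Proof. by apply: complexI; rewrite -cabsE normrM !cabsE -rmorphM. Qed.

Lemma cabsV z : cabs z^-1 = (cabs z)^-1.
Proof. by apply: complexI; rewrite -cabsE normfV !cabsE -fmorphV. Qed.

Lemma cabsX z n : cabs (z ^+ n) = cabs z ^+ n.
Proof. by apply: complexI; rewrite -cabsE normrX !cabsE -rmorphXn. Qed.

Lemma cabsN z : cabs (- z) = cabs z.
Proof. by apply: complexI; rewrite -!cabsE normrN. Qed.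

Lemma cabsB z w : cabs (z - w) = cabs (w - z).
Proof. by rewrite -cabsN opprB. Qed.

Lemma cabs0 : cabs 0 = 0.
Proof. by apply: complexI; rewrite -cabsE normr0. Qed.

Lemma cabs1 : cabs 1 = 1.
Proof. by apply: complexI; rewrite -cabsE normr1. Qed.

Lemma cabs_eq0 z : (cabs z == 0) = (z == 0).
Proof. by rewrite -(inj_eq (@complexI R)) -cabsE normr_eq0. Qed.

Lemma cabsR (a : R) : cabs a%:C = `|a|.
Proof. by rewrite /cabs normc_def /= expr0n addr0 sqrtr_sqr. Qed.

Lemma cabs_nat n : cabs n%:R = n%:R.
Proof. by rewrite -(rmorph_nat (real_complex R)) cabsR normr_nat. Qed.

Lemma cabsD z w : cabs (z + w) <= cabs z + cabs w.
Proof. by rewrite -lecR rmorphD /= -!cabsE ler_normD. Qed.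

Lemma cabsBD z w : cabs (z - w) <= cabs z + cabs w.
Proof. by rewrite -(cabsN w) cabsD. Qed.

Lemma cabs_dist z w v : cabs (z - v) <= cabs (z - w) + cabs (w - v).
Proof. by have := cabsD (z - w) (w - v); rewrite subrKA. Qed.

Lemma cabs_sum I (r : seq I) (P : pred I) (F : I -> R[i]) :
  cabs (\sum_(i <- r | P i) F i) <= \sum_(i <- r | P i) cabs (F i).
Proof.
elim/big_rec2: _ => [|i y x _ xy]; first by rewrite cabs0.
by rewrite (le_trans (cabsD _ _)) ?lerD2l.
Qed.

Lemma Re_cabs z : `|complex.Re z| <= cabs z.
Proof. by rewrite -lecR -cabsE normc_ge_Re. Qed.

Lemma Im_cabs z : `|complex.Im z| <= cabs z.
Proof.
have := Re_cabs (z * 'i%C); rewrite ReiNIm normrN => /le_trans; apply.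
by rewrite cabsM {2}/cabs normc_def /= expr0n expr1n add0r sqrtr1 mulr1.
Qed.

Lemma cabs_ReIm z : cabs z <= `|complex.Re z| + `|complex.Im z|.
Proof.
rewrite {1}[z]complexE (le_trans (cabsD _ _)) // cabsR lerD2l cabsM cabsR.
by rewrite {1}/cabs normc_def /= expr0n expr1n add0r sqrtr1 mul1r.
Qed.

(** Balls of [R[i]^o] have radii in [R[i]], but a positive element of [R[i]] is real, so epsilon may
    range over [R]. *)
Lemma cvg_cabs T (F : set_system T) {FF : Filter F} (f : T -> R[i]^o)
    (l : R[i]) :
  (f @ F --> (l : R[i]^o)) <->
  forall e : R, 0 < e -> \forall x \near F, cabs (f x - l) < e.
Proof.
split=> [/cvgrPdistC_lt fl e e0|fl].
  have e0C : 0 < (e%:C : R[i]) by rewrite ltcR.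
  by apply: filterS (fl _ e0C) => x; rewrite cabsE ltcR.
apply/cvgrPdistC_lt => e; rewrite ltcE /= => /andP[/eqP e1 /fl].
apply: filterS => x; rewrite (_ : e = (complex.Re e)%:C).
  by rewrite cabsE ltcR.
by rewrite RRe_real //; apply/complex_realP; exists (complex.Re e); case: e e1 => a b /= ->.
Qed.

(** The intervals [u n - e n, u n + e n] meet pairwise, so the supremum of their left ends lies in
    all of them. *)
Lemma real_rate_limit (u e : nat -> R) :
  (forall n m, (n <= m)%N -> `|u m - u n| <= e n) ->
  exists l, forall n, `|l - u n| <= e n.
Proof.
move=> ue; pose S := [set u n - e n | n in [set: nat]].
have ub n m : u n - e n <= u m + e m.
  case: (leqP n m) => [/ue|/ltnW /ue]; rewrite ler_norml => /andP[? ?].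
    have : 0 <= e m by rewrite (le_trans (normr_ge0 _) (ue m m _)).
    lra.
  have : 0 <= e n by rewrite (le_trans (normr_ge0 _) (ue n n _)).
  lra.
have supS : has_sup S.
  by split; [exists (u 0%N - e 0%N), 0%N|exists (u 0%N + e 0%N) => _ [n _ <-]].
exists (sup S) => n; rewrite ler_norml.
have : u n - e n <= sup S by apply: ub_le_sup; [case: supS|exists n].
have : sup S <= u n + e n by apply: ge_sup; [case: supS|move=> _ [m _ <-]].
lra.
Qed.

(** The factor 2 comes from adding the errors of the real and imaginary parts. *)
Lemma complex_rate_limit (u : nat -> R[i]) (e : nat -> R) :
  (forall n m, (n <= m)%N -> cabs (u m - u n) <= e n) ->
  exists l, forall n, cabs (l - u n) <= 2 * e n.
Proof.
move=> ue.
have [l1 H1] : exists l, forall n, `|l - complex.Re (u n)| <= e n.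
  apply: real_rate_limit => n m nm; apply: le_trans (ue _ _ nm).
  by apply: le_trans (Re_cabs _); case: (u m) (u n) => a b [c d].
have [l2 H2] : exists l, forall n, `|l - complex.Im (u n)| <= e n.
  apply: real_rate_limit => n m nm; apply: le_trans (ue _ _ nm).
  by apply: le_trans (Im_cabs _); case: (u m) (u n) => a b [c d].
exists (l1 +i* l2) => n; apply: le_trans (cabs_ReIm _) _.
have := lerD (H1 n) (H2 n); case: (u n) => a b /=; lra.
Qed.

Lemma cvg_rate (u : nat -> R[i]^o) (e : nat -> R) (l : R[i]) :
  (forall n, cabs (l - u n) <= e n) -> e @ \oo --> (0 : R) ->
  u @ \oo --> (l : R[i]^o).
Proof.
move=> ue e0; apply/cvg_cabs => d d0.
have /cvgrPdist_lt/(_ _ d0) := e0.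
apply: filterS => n; rewrite sub0r normrN => en.
rewrite cabsB (le_lt_trans (ue n)) //.
by rewrite (le_lt_trans (ler_norm _)).
Qed.

Lemma cexpD z w : cexp (z + w) = cexp z * cexp w.
Proof.
case: z w => a b [c d]; rewrite /cexp /= expRD cosD sinD.
by apply/eqP; rewrite eq_complex /=; apply/andP; split; apply/eqP; ring.
Qed.

Lemma cexp0 : cexp 0 = 1 :> R[i].
Proof. by rewrite /cexp /= expR0 cos0 sin0 mul1r. Qed.

Lemma cexpN z : cexp (- z) = (cexp z)^-1.
Proof.
have zz : cexp z * cexp (- z) = 1 by rewrite -cexpD subrr cexp0.
have z0 : cexp z != 0.
  by apply/eqP => z0; have := oner_neq0 R[i]; rewrite -zz z0 mul0r eqxx.
by apply: (mulfI z0); rewrite zz mulfV.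
Qed.

Lemma cexp_sum I (r : seq I) (P : pred I) (F : I -> R[i]) :
  cexp (\sum_(i <- r | P i) F i) = \prod_(i <- r | P i) cexp (F i).
Proof. by elim/big_rec2: _ => [|i y x _ <-]; rewrite ?cexp0 ?cexpD. Qed.

End ComplexModulus.

(** * The power series of the logarithm *)


Section ComplexLog.
Variable R : realType.
Implicit Types z w : R[i].

Definition logpart (n : nat) z : R[i] := \sum_(1 <= l < n) z ^+ l / l%:R.

(** This is -log(1 - z), so that at z = chi(p)/p^x it is the logarithm of an Euler factor. *)
Definition clog z : R[i] := \big[+%R/0]_(1 <= l <oo) (z ^+ l / l%:R : R[i]^o).

Lemma geometric_tail (r : R) (n m : nat) :
  0 <= r < 1 -> (n <= m)%N -> \sum_(n <= l < m) r ^+ l <= r ^+ n / (1 - r).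
Proof.
move=> /andP[r0 r1] nm; rewrite ler_pdivlMr ?subr_gt0 //.
suff -> : (\sum_(n <= l < m) r ^+ l) * (1 - r) = r ^+ n - r ^+ m.
  by rewrite gerBl exprn_ge0.
rewrite mulr_suml -(opprB (r ^+ m)) -(telescope_sumr (GRing.exp r) nm) -sumrN.
by apply: eq_bigr => i _; rewrite exprS; ring.
Qed.

Lemma cabs_logterm z (r : R) l : cabs z <= r -> cabs (z ^+ l / l%:R) <= r ^+ l.
Proof.
move=> zr; rewrite cabsM cabsX cabsV cabs_nat.
have zl : cabs z ^+ l <= r ^+ l by rewrite lerXn2r ?nnegrE ?cabs_ge0 ?(le_trans (cabs_ge0 z)).
case: l zl => [|l] zl; first by rewrite invr0 mulr0 expr0.
rewrite (le_trans _ zl) // ler_piMr ?exprn_ge0 ?cabs_ge0 //.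
by rewrite invf_le1 ?ltr0n // ler1n.
Qed.

Lemma logpart_tail z (r : R) n m : (0 < n)%N -> (n <= m)%N ->
  cabs z <= r -> r < 1 -> cabs (logpart m z - logpart n z) <= r ^+ n / (1 - r).
Proof.
move=> n0 nm zr r1; rewrite /logpart (big_cat_nat n0 nm) //= addrAC subrr add0r.
rewrite (le_trans (cabs_sum _ _ _)) //.
apply: le_trans (geometric_tail _ nm); last by rewrite r1 (le_trans (cabs_ge0 z)).
by apply: ler_sum => l _; apply: cabs_logterm.
Qed.

Lemma cvg_geometric_rate (r c : R) : 0 <= r < 1 ->
  (fun n => c * r ^+ n) @ \oo --> (0 : R).
Proof.
move=> /andP[r0 r1]; rewrite -(mulr0 c); apply: cvgMr.
by apply: cvg_expr; rewrite ger0_norm.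
Qed.

Lemma clog_cvg_rate z (r : R) n : (0 < n)%N -> cabs z <= r -> r < 1 ->
  cabs (clog z - logpart n z) <= 2 * (r ^+ n / (1 - r)).
Proof.
case: n => // n _ zr r1; have r0 := le_trans (cabs_ge0 z) zr.
have [l Hl] : exists l, forall n, cabs (l - logpart n.+1 z) <= 2 * (r ^+ n.+1 / (1 - r)).
  apply: (@complex_rate_limit _ (fun n => logpart n.+1 z) (fun n => r ^+ n.+1 / (1 - r))).
  by move=> k m km; apply: logpart_tail.
suff -> : clog z = l by apply: Hl.
rewrite /clog; apply: (@cvg_lim (R[i]^o)); first exact: norm_hausdorff.
rewrite -cvg_shiftS /=; apply: (cvg_rate Hl).
have := @cvg_geometric_rate r (2 * r / (1 - r)); rewrite r0 r1 => /(_ erefl).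
apply: cvg_trans; apply: near_eq_cvg; near=> k.
by rewrite exprS; ring.
Unshelve. all: by end_near.
Qed.

Lemma cabs_clog z : cabs z < 1 -> cabs (clog z) <= 2 * (cabs z / (1 - cabs z)).
Proof.
move=> z1; have := @clog_cvg_rate z (cabs z) 1%N isT (lexx _) z1.
by rewrite /logpart big_geq // subr0 expr1.
Qed.

Lemma cabs_clogB z : cabs z < 1 ->
  cabs (clog z - z) <= 2 * (cabs z ^+ 2 / (1 - cabs z)).
Proof.
move=> z1; have := @clog_cvg_rate z (cabs z) 2%N isT (lexx _) z1.
by rewrite /logpart big_nat1 divr1 expr1.
Qed.

(** Factoring z^l - w^l gives l terms of size at most r^(l-1) |z - w|; the division by l cancels
    their number and a geometric series remains. *)
Lemma logpart_lipschitz z w (r : R) n : cabs z <= r -> cabs w <= r -> r < 1 ->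
  cabs (logpart n z - logpart n w) <= cabs (z - w) / (1 - r).
Proof.
move=> zr wr r1; have r0 := le_trans (cabs_ge0 z) zr.
case: n => [|n].
  by rewrite /logpart !big_geq // subrr cabs0 divr_ge0 ?cabs_ge0 ?subr_ge0 ?ltW.
rewrite /logpart -sumrB (le_trans (cabs_sum _ _ _)) //.
apply: (@le_trans _ _ (\sum_(1 <= l < n.+1) cabs (z - w) * r ^+ l.-1)).
  rewrite !big_add1 /=; apply: ler_sum => l _.
  rewrite -mulrBl subrXX mulrAC -mulrA cabsM ler_wpM2l ?cabs_ge0 //.
  rewrite cabsM cabsV cabs_nat ler_pdivrMl ?ltr0n //.
  rewrite (le_trans (cabs_sum _ _ _)) //.
  rewrite (_ : l.+1%:R * r ^+ l = \sum_(i < l.+1) r ^+ l); last first.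
    by rewrite sumr_const card_ord mulr_natl.
  apply: ler_sum => i _; rewrite cabsM !cabsX /=.
  rewrite (_ : r ^+ l = r ^+ (l - i) * r ^+ i); last by rewrite -exprD subnK // -ltnS.
  by apply: ler_pM; rewrite ?exprn_ge0 ?cabs_ge0 // lerXn2r ?nnegrE ?cabs_ge0.
rewrite big_add1 /= -mulr_sumr ler_wpM2l ?cabs_ge0 //.
by have := @geometric_tail r 0 n; rewrite r0 r1 expr0 div1r; apply.
Qed.

Lemma clog_lipschitz z w (r : R) : cabs z <= r -> cabs w <= r -> r < 1 ->
  cabs (clog z - clog w) <= cabs (z - w) / (1 - r).
Proof.
move=> zr wr r1; have r0 := le_trans (cabs_ge0 z) zr.
apply/ler_addgt0Pr => e e0.
have /cvgrPdist_lt/(_ _ e0) := @cvg_geometric_rate r (4 / (1 - r)) (introT andP (conj r0 r1)).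
case=> N _ /(_ N.+1 (leqnSn N)); rewrite sub0r normrN ger0_norm; last first.
  by rewrite mulr_ge0 ?exprn_ge0 // divr_ge0 ?subr_ge0 ?ltW.
move=> HN.
have H1 := clog_cvg_rate (ltn0Sn N) zr r1.
have H2 := clog_cvg_rate (ltn0Sn N) wr r1; rewrite cabsB in H2.
have H3 := logpart_lipschitz N.+1 zr wr r1.
have := cabs_dist (clog z) (logpart N.+1 z) (clog w).
have := cabs_dist (logpart N.+1 z) (logpart N.+1 w) (clog w).
set a := r ^+ N.+1 in H1 H2 HN *.
have E : 4 / (1 - r) * a = 2 * (a / (1 - r)) + 2 * (a / (1 - r)) by ring.
rewrite E in HN; lra.
Qed.

(** When [a] and [b] are the real and imaginary parts of the powers of z, [U a n t] and [U b n t]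
    are those of [logpart n.+1] at t z; derivatives can then be taken over [R]. *)
Let U (a : nat -> R) n (t : R) := \sum_(l < n) a l.+1 / l.+1%:R * t ^+ l.+1.
Let DU (a : nat -> R) n (t : R) := \sum_(l < n) a l.+1 * t ^+ l.

Let is_derive_U a n (t : R) : is_derive t (1 : R) (U a n) (DU a n t).
Proof.
have -> : U a n = \sum_(l < n) (a l.+1 / l.+1%:R) \*: ((@id R) ^+ l.+1).
  by rewrite fct_sumE; apply/funext => x; apply: eq_bigr => l _; rewrite fctE.
apply: is_derive_eq.
by apply: eq_bigr => l _ /=; rewrite /GRing.scale /= mulr1 -mulrA mulKf.
Qed.

(* The function G(t) = cexp (logpart n.+1 (t z)) (1 - t z) on [0, 1] satisfies
   G(0) = 1 and G'(t) = - z (t z)^n cexp (logpart n.+1 (t z)), which tends to 0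
   uniformly in t as n grows.  In [key], [f] is the real part of G or minus its
   imaginary part, according to [sgn]. *)
Lemma cexp_clog_mul z : cabs z < 1 -> cexp (clog z) * (1 - z) = 1.
Proof.
move=> z1; have z0 := cabs_ge0 z.
pose x := complex.Re z; pose y := complex.Im z.
pose a n := complex.Re (z ^+ n); pose b n := complex.Im (z ^+ n).
pose M := cabs z / (1 - cabs z).
have DUE n t : (DU a n t +i* DU b n t) = \sum_(l < n) z ^+ l.+1 * (t%:C) ^+ l.
  rewrite /DU; elim/big_rec3: _ => [//|i u v w _ <-].
  rewrite -rmorphXn /= /a /b; case: (z ^+ i.+1) => p q.
  by apply/eqP; rewrite eq_complex /=; apply/andP; split; apply/eqP; ring.
have UE n t : (U a n t +i* U b n t) = logpart n.+1 (t%:C * z).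
  rewrite /U /logpart big_add1 /= big_mkord; elim/big_rec3: _ => [//|i u v w _ <-].
  rewrite exprMn -rmorphXn /= -(rmorph_nat (real_complex R)) -fmorphV /= /a /b.
  case: (z ^+ i.+1) => p q.
  by apply/eqP; rewrite eq_complex /=; apply/andP; split; apply/eqP; ring.
(* The derivative of the truncated logarithm is z times a geometric sum, so multiplication by 1 - t
   z leaves a single small term. *)
have geo n t : (1 - t%:C * z) * (DU a n t +i* DU b n t) - z = - (z * (t%:C * z) ^+ n).
  rewrite DUE (_ : \sum_(l < n) _ = z * \sum_(l < n) (t%:C * z) ^+ l); last first.
    by rewrite mulr_sumr; apply: eq_bigr => l _; rewrite exprS exprMn; ring.
  by rewrite mulrCA (_ : 1 - t%:C * z = - (t%:C * z - 1)) ?mulNr -?subrX1; ring.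
have UM n t : 0 <= t <= 1 -> U a n t <= M.
  move=> /andP[t0 t1]; have := Re_cabs (logpart n.+1 (t%:C * z)); rewrite -UE /=.
  rewrite ler_norml => /andP[_ /le_trans]; apply.
  have tz : cabs (t%:C * z) <= cabs z.
    by rewrite cabsM cabsR ger0_norm // ler_piMl.
  have := @logpart_tail (t%:C * z) (cabs z) 1 n.+1 isT isT tz z1.
  by rewrite UE {2}/logpart big_geq // subr0 expr1.
have gc n t : 0 <= t <= 1 -> cabs ((1 - t%:C * z) * (DU a n t +i* DU b n t) - z) <= cabs z ^+ n.
  move=> /andP[t0 t1]; rewrite geo cabsN cabsM cabsX.
  apply: (@le_trans _ _ (cabs (t%:C * z) ^+ n)).
    by rewrite ler_piMl ?exprn_ge0 ?cabs_ge0 // ltW.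
  rewrite lerXn2r ?nnegrE ?cabs_ge0 //.
  by rewrite cabsM cabsR ger0_norm // ler_piMl.
pose P (t : R) := 1 - t * x; pose S (t : R) := - (t * y).
have dP (t : R) : is_derive t (1 : R) P (- x).
  have -> : P = cst 1 - (x \*: @id R) by apply/funext => u; rewrite /P !fctE /GRing.scale /= mulrC.
  by apply: is_derive_eq; rewrite sub0r /GRing.scale /= mulr1.
have dS (t : R) : is_derive t (1 : R) S (- y).
  have -> : S = (- y) \*: @id R by apply/funext => u; change (- (u * y) = - y * u); ring.
  by apply: is_derive_eq; rewrite /GRing.scale /= mulr1.
have key n (sgn : bool) : `|complex.Re ((if sgn then 1 else 'i%C) * (cexp (logpart n.+1 z) * (1 - z) - 1))| <= expR M * 2 * cabs z ^+ n.
  pose f1 := (expR \o U a n) * ((cos \o U b n) * P - (sin \o U b n) * S).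
  pose f2 := - ((expR \o U a n) * ((cos \o U b n) * S + (sin \o U b n) * P)).
  pose f : R -> R := if sgn then f1 else f2.
  pose c1 t := complex.Re ((1 - t%:C * z) * (DU a n t +i* DU b n t) - z).
  pose c2 t := complex.Im ((1 - t%:C * z) * (DU a n t +i* DU b n t) - z).
  pose df t := if sgn then expR (U a n t) * (cos (U b n t) * c1 t - sin (U b n t) * c2 t)
    else - (expR (U a n t) * (cos (U b n t) * c2 t + sin (U b n t) * c1 t)).
  have dU t := is_derive_U a n t.
  have dV t := is_derive_U b n t.
  have dE t : is_derive t (1 : R) (expR \o U a n) (expR (U a n t) * DU a n t).
    exact: is_derive1_comp.
  have dC t : is_derive t (1 : R) (cos \o U b n) (- sin (U b n t) * DU b n t).
    exact: is_derive1_comp.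
  have dSi t : is_derive t (1 : R) (sin \o U b n) (cos (U b n t) * DU b n t).
    exact: is_derive1_comp.
  have df_ t : is_derive t (1 : R) f (df t).
    have c1E : c1 t = DU a n t * P t - DU b n t * S t - x.
      by rewrite /c1 /P /S /x /y; case: (z) => p q /=; ring.
    have c2E : c2 t = DU a n t * S t + DU b n t * P t - y.
      by rewrite /c2 /P /S /x /y; case: (z) => p q /=; ring.
    rewrite /f /df c1E c2E; case: ifP => _.
      by apply: is_derive_eq; rewrite !fctE /= /GRing.scale /=; ring.
    by apply: is_derive_eq; rewrite !fctE /= /GRing.scale /=; ring.
  have dfb t : 0 <= t <= 1 -> `|df t| <= expR M * 2 * cabs z ^+ n.
    move=> t01.
    have H1 : `|c1 t| <= cabs z ^+ n by apply: le_trans (gc n t t01); apply: Re_cabs.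
    have H2 : `|c2 t| <= cabs z ^+ n by apply: le_trans (gc n t t01); apply: Im_cabs.
    have [C S_] := (cos_max (U b n t), sin_max (U b n t)).
    have E1 : expR (U a n t) <= expR M by rewrite ler_expR UM.
    rewrite /df -mulrA; case: ifP => _; rewrite ?normrN normrM ger0_norm ?expR_ge0 //;
      apply: ler_pM; rewrite ?expR_ge0 ?normr_ge0 // mulr_natl mulr2n.
    - rewrite (le_trans (ler_normB _ _)) // !normrM lerD //.
        by rewrite -[leRHS]mul1r ler_pM.
      by rewrite -[leRHS]mul1r ler_pM.
    - rewrite (le_trans (ler_normD _ _)) // !normrM lerD //.
        by rewrite -[leRHS]mul1r ler_pM.
      by rewrite -[leRHS]mul1r ler_pM.
  have [|c c01 fc] := @MVT_segment R f df 0 1 ler01.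
    by apply: derivable_within_continuous => t _; apply: ex_derive.
  have -> : complex.Re ((if sgn then 1 else 'i%C) * (cexp (logpart n.+1 z) * (1 - z) - 1)) = f 1 - f 0.
    have U0 h : U h n 0 = 0.
      by rewrite /U big1 // => i _; rewrite expr0n mulr0.
    have := UE n 1; rewrite mul1r => <-.
    rewrite /f /f1 /f2; case: ifP => _; rewrite !fctE /= !U0 expR0 cos0 sin0 /P /S /x /y /cexp /=;
    by case: (z) => p q /=; ring.
  by rewrite fc subr0 mulr1; apply: dfb; move: c01; rewrite in_itv.
have cvgL : (fun n => logpart n.+1 z : R[i]^o) @ \oo --> (clog z : R[i]^o).
  apply: (@cvg_rate _ _ (fun n => (2 * cabs z / (1 - cabs z)) * cabs z ^+ n)).
    move=> n; apply: le_trans (clog_cvg_rate (ltn0Sn n) (lexx _) z1) _.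
    by rewrite exprS le_eqVlt; apply/orP; left; apply/eqP; ring.
  by apply: cvg_geometric_rate; rewrite z0 z1.
have cvgRe (u : nat -> R[i]) (l : R[i]) : (fun n => u n : R[i]^o) @ \oo --> (l : R[i]^o) ->
   (fun n => complex.Re (u n)) @ \oo --> complex.Re l.
  move=> /cvg_cabs ul; apply/cvgrPdistC_lt => e /ul; apply: filterS => n.
  by apply: le_lt_trans; apply: le_trans (Re_cabs _); case: (u n) (l) => p q [].
have cvgIm (u : nat -> R[i]) (l : R[i]) : (fun n => u n : R[i]^o) @ \oo --> (l : R[i]^o) ->
   (fun n => complex.Im (u n)) @ \oo --> complex.Im l.
  move=> /cvg_cabs ul; apply/cvgrPdistC_lt => e /ul; apply: filterS => n.
  by apply: le_lt_trans; apply: le_trans (Im_cabs _); case: (u n) (l) => p q [].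
have cR := cvgRe _ _ cvgL; have cI := cvgIm _ _ cvgL.
have cE : (fun n => expR (complex.Re (logpart n.+1 z))) @ \oo --> expR (complex.Re (clog z)).
  by apply: continuous_cvg cR; apply: continuous_expR.
have cC : (fun n => cos (complex.Im (logpart n.+1 z))) @ \oo --> cos (complex.Im (clog z)).
  by apply: continuous_cvg cI; apply: continuous_cos.
have cS : (fun n => sin (complex.Im (logpart n.+1 z))) @ \oo --> sin (complex.Im (clog z)).
  by apply: continuous_cvg cI; apply: continuous_sin.
have bound0 (v : nat -> R) l : (forall n, `|v n| <= expR M * 2 * cabs z ^+ n) -> v @ \oo --> l -> l = 0.
  move=> vb vl; suff v0 : v @ \oo --> (0 : R) by rewrite -(cvg_lim _ vl) ?(cvg_lim _ v0).
  apply/cvgrPdist_lt => e e0.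
  have /cvgrPdist_lt/(_ _ e0) := @cvg_geometric_rate (cabs z) (expR M * 2) (introT andP (conj z0 z1)).
  apply: filterS => n; rewrite !sub0r !normrN => /(le_lt_trans _) -> //.
  by rewrite (le_trans (vb n)) // ler_norm.
apply/eqP; rewrite -subr_eq0 eq_complex /=; apply/andP; split; apply/eqP.
  apply: (bound0 _ _ (fun n => key n true)).
  rewrite (_ : complex.Re _ = expR (complex.Re (clog z)) * cos (complex.Im (clog z)) * (1 - x) -
     expR (complex.Re (clog z)) * sin (complex.Im (clog z)) * (- y) - 1); last first.
    by rewrite /cexp /x /y; case: (clog z) (z) => p q [u v] /=; ring.
  rewrite (_ : (fun n => _) = fun n => expR (complex.Re (logpart n.+1 z)) * cos (complex.Im (logpart n.+1 z)) * (1 - x) -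
     expR (complex.Re (logpart n.+1 z)) * sin (complex.Im (logpart n.+1 z)) * (- y) - 1); last first.
    apply/funext => n; rewrite /cexp /x /y; case: (logpart n.+1 z) (z) => p q [u v] /=; ring.
  apply: cvgB; last exact: cvg_cst.
  by apply: cvgB; apply: cvgMl; apply: cvgM.
apply: oppr_inj; rewrite oppr0.
apply: (bound0 _ _ (fun n => key n false)).
rewrite (_ : - complex.Im _ = - (expR (complex.Re (clog z)) * sin (complex.Im (clog z)) * (1 - x) +
     expR (complex.Re (clog z)) * cos (complex.Im (clog z)) * (- y))); last first.
  by rewrite /cexp /x /y; case: (clog z) (z) => p q [u v] /=; ring.
rewrite (_ : (fun n => _) = fun n => - (expR (complex.Re (logpart n.+1 z)) * sin (complex.Im (logpart n.+1 z)) * (1 - x) +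
     expR (complex.Re (logpart n.+1 z)) * cos (complex.Im (logpart n.+1 z)) * (- y))); last first.
  apply/funext => n; rewrite /cexp /x /y; case: (logpart n.+1 z) (z) => p q [u v] /=; ring.
by apply: cvgN; apply: cvgD; apply: cvgMl; apply: cvgM.
Qed.

End ComplexLog.

(** * Characters and counting *)


(** Turns a cardinality bound into one for repetition-free lists, over which moments can be summed;
    an infinite set would contain a list that is too long. *)
Lemma card_leI_uniq (T : choiceType) (A : set T) (N : nat) :
  (forall X : seq T, uniq X -> (forall x, x \in X -> A x) -> (size X <= N)%N) ->
  (A #<= `I_N)%card.
Proof.
move=> AN; have [finA|infA] := pselect (finite_set A).
  have [n An] := (finite_setP A).1 finA.
  apply: card_le_trans (_ : (A #<= `I_n)%card) _.
    by move: An; rewrite card_eq_le => /andP[].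
  rewrite card_le_II -(card_fset_set An); apply: AN; first exact: fset_uniq.
  move=> x xA; have : [set` fset_set A] x by [].
  by rewrite fset_setK.
have [B BA NB] := infinite_set_fset N.+1 infA.
have := AN _ (fset_uniq B) (fun x xB => BA x xB).
by rewrite leqNgt NB.
Qed.

Section Characters.
Variable R : realType.
Implicit Types (chi psi : nat -> R[i]) (q : nat).

Lemma char_mod q chi n : (forall n, chi (n + q)%N = chi n) -> chi (n %% q)%N = chi n.
Proof.
move=> per; rewrite {2}(divn_eq n q) addnC.
by elim: (n %/ q)%N => [|k IH]; rewrite ?mul0n ?addn0 // mulSn addnCA addnC per -IH.
Qed.

(** By Euler's theorem chi n is a root of unity. *)
Lemma char_norm1 q chi n : dirichlet_character q chi -> coprime n q -> `|chi n| = 1.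
Proof.
case=> q0 c1 cM per _ cop.
have cX k : chi (n ^ k)%N = chi n ^+ k.
  by elim: k => [|k IH]; rewrite ?expn0 ?c1 // expnS cM IH exprS.
have /(congr1 (fun z => `|z|)) : chi n ^+ totient q = 1.
  by rewrite -cX -(char_mod _ per) cyclic.Euler_exp_totient // (char_mod _ per) c1.
rewrite normrX normr1 => /eqP; rewrite pexpr_eq1 ?totient_gt0 //.
by move/eqP.
Qed.

Lemma char_eq0 q chi n : dirichlet_character q chi -> ~~ coprime n q -> chi n = 0.
Proof. by case=> _ _ _ _ cop; rewrite -cop negbK => /eqP. Qed.

Lemma cabs_char q chi n : dirichlet_character q chi -> cabs (chi n) <= 1.
Proof.
move=> chiD; have [cop|/(char_eq0 chiD) ->] := boolP (coprime n q).
  by rewrite -cabs_le (char_norm1 chiD).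
by rewrite cabs0 ler01.
Qed.

(** Multiplication by m permutes the residues, so the sum equals h(m) times itself. It is applied to
    chi and to the product of chi with a conjugate character. *)
Lemma periodic_sum_eq0 q (h : nat -> R[i]) m :
  (0 < q)%N -> (forall n, h (n + q)%N = h n) ->
  (forall n k, h (n * k)%N = h n * h k) -> coprime m q -> h m != 1 ->
  \sum_(r < q) h r = 0.
Proof.
move=> q0 per hM cop hm.
pose f (r : 'I_q) : 'I_q := Ordinal (ltn_pmod (m * r) q0).
have f_inj : injective f.
  move=> r s /(congr1 val) /= /eqP rs; apply: val_inj => /=.
  wlog sr : r s rs / (s <= r)%N.
    by move=> H; case/orP: (leq_total s r) => ?; [|symmetry]; apply: H; rewrite // eq_sym.
  move: rs; rewrite eqn_mod_dvd ?leq_mul2l ?sr ?orbT // -mulnBr Gauss_dvdr 1?coprime_sym //.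
  rewrite -eqn_mod_dvd // !modn_small ?ltn_ord //.
  by move/eqP.
have E : \sum_(r < q) h r = h m * \sum_(r < q) h r.
  rewrite {1}(reindex_inj f_inj) /= mulr_sumr; apply: eq_bigr => r _.
  by rewrite (char_mod _ per) hM.
have /eqP : (1 - h m) * \sum_(r < q) h r = 0 by rewrite mulrBl mul1r -E subrr.
by rewrite mulf_eq0 subr_eq0 eq_sym (negbTE hm) => /eqP.
Qed.

Definition nonprincipal q chi : Prop :=
  dirichlet_character q chi /\ exists2 m, coprime m q & chi m != 1.

(** Otherwise chi would be induced by the constant character modulo 1, a proper divisor of q. *)
Lemma primitive_nonprincipal q chi :
  primitive_character q chi -> (1 < q)%N -> nonprincipal q chi.
Proof.
move=> [chiD prim] q1; split=> //; apply: contrapT => H.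
apply: (prim 1%N (dvd1n q) q1); exists (fun=> 1); split.
  split=> // [m n|n]; first by rewrite mulr1.
  by rewrite oner_neq0 coprimen1.
by move=> n cop; apply: contrapT => /eqP chin; apply: H; exists n.
Qed.

Lemma char_window q chi u : nonprincipal q chi -> \sum_(u <= k < u + q) chi k = 0.
Proof.
move=> [[q0 c1 cM per cop] [m mq chim]]; elim: u => [|u IH].
  by rewrite add0n big_mkord; apply: periodic_sum_eq0 mq chim.
have := IH; rewrite big_ltn; last by rewrite -addn1 leq_add2l.
move=> E; rewrite addSn big_nat_recr /=; last by rewrite -addn1 leq_add2l.
by rewrite per addrC.
Qed.

(** Full periods cancel and fewer than q terms remain. *)
Lemma char_partial_sum q chi u v : nonprincipal q chi ->
  cabs (\sum_(u <= k < v) chi k) <= q%:R.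
Proof.
move=> np; have chiD := np.1.
have [n] := ubnP (v - u)%N; elim: n u => // n IH u.
case: (leqP q (v - u)%N) => [qvu|vuq] vun.
  have q0 : (0 < q)%N by case: chiD.
  rewrite (@big_cat_nat _ _ _ (u + q)%N) ?leq_addr //=; last by lia.
  rewrite char_window // add0r; apply: IH; lia.
rewrite (le_trans (cabs_sum _ _ _)) //.
apply: (@le_trans _ _ (\sum_(u <= k < v) 1)).
  by apply: ler_sum => k _; apply: cabs_char chiD.
by rewrite sumr_const_nat ler_nat ltnW.
Qed.

Lemma char_orthogonality q chi psi :
  dirichlet_character q chi -> dirichlet_character q psi -> chi <> psi ->
  \sum_(r < q) chi r * Num.conj (psi r) = 0.
Proof.
move=> chiD psiD neq; have [q0 _ cM per _] := chiD; have [_ _ pM pper _] := psiD.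
have [m /eqP chim] : exists m, chi m <> psi m.
  by apply: contrapT => H; apply: neq; apply/funext => n; apply: contrapT => H'; apply: H; exists n.
have mq : coprime m q.
  by apply: contraNT chim => nm; rewrite (char_eq0 chiD nm) (char_eq0 psiD nm).
apply: (@periodic_sum_eq0 q (fun r => chi r * Num.conj (psi r)) m) => //.
- by move=> n; rewrite per pper.
- by move=> n k; rewrite cM pM rmorphM; ring.
- have /(congr1 (fun x => x ^+ 2)) := char_norm1 psiD mq.
  rewrite normCK expr1n => pp; apply: contraNneq chim => E.
  by rewrite -[chi m]mulr1 -pp mulrCA E mulr1.
Qed.

Lemma bessel q (X : seq (nat -> R[i])) (a : 'I_q -> R[i]) :
  uniq X -> (forall chi, chi \in X -> dirichlet_character q chi) ->
  \sum_(chi <- X) cabs (\sum_(r < q) a r * chi r) ^+ 2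
    <= q%:R * \sum_(r < q) cabs (a r) ^+ 2.
Proof.
case: X => [|chi0 X'].
  by move=> _ _; rewrite big_nil mulr_ge0 // sumr_ge0 // => i _; rewrite exprn_ge0 ?cabs_ge0.
set X := chi0 :: X' => uX XD.
have q0 : (0 < q)%N by case: (XD chi0 (mem_head _ _)).
have [c1 q1] : chi0 1%N = 1 /\ coprime 1 q by split; [case: (XD chi0 (mem_head _ _))|exact: coprime1n].
pose phi : R[i] := \sum_(r < q) (coprime r q)%:R.
have phi_gt0 : 0 < phi.
  rewrite /phi lt_neqAle sumr_ge0 ?andbT // eq_sym psumr_eq0 //.
  apply/allPn; exists (Ordinal (ltn_pmod 1 q0)); first by rewrite mem_index_enum.
  by rewrite /= coprime_modl q1 oner_eq0.
have phi_le : phi <= q%:R.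
  rewrite /phi -[in leRHS](card_ord q) -sumr_const; apply: ler_sum => r _.
  by case: coprime; rewrite ?ler01.
have orth chi psi : chi \in X -> psi \in X ->
    \sum_(r < q) chi r * Num.conj (psi r) = (if chi == psi then phi else 0).
  move=> chiX psiX; case: eqP => [<-|]; last exact: char_orthogonality (XD _ _) (XD _ _).
  apply: eq_bigr => r _; rewrite -normCK; have [cop|/(char_eq0 (XD _ chiX)) ->] := boolP (coprime r q).
    by rewrite (char_norm1 (XD _ chiX)) // expr1n.
  by rewrite normr0 expr0n.
pose c chi := \sum_(r < q) a r * chi r.
(* [S] is the orthogonal projection of [a] on the span of the conjugate characters, each of squared
   norm [phi], and [T] is the squared norm of [S]; the inequality is the positivity of the squared
   norm of a - S. *)
pose S (r : 'I_q) := phi^-1 * \sum_(chi <- X) c chi * Num.conj (chi r).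
pose T := phi^-1 * \sum_(chi <- X) `|c chi| ^+ 2.
have ScE chi : chi \in X -> \sum_(r < q) S r * chi r = c chi.
  move=> chiX.
  transitivity (phi^-1 * \sum_(psi <- X) c psi * \sum_(r < q) chi r * Num.conj (psi r)).
    under [in RHS]eq_bigr do rewrite mulr_sumr.
    rewrite exchange_big /= mulr_sumr; apply: eq_bigr => r _.
    by rewrite /S -mulrA mulr_suml; congr (_ * _); apply: eq_bigr => psi _; ring.
  rewrite (bigD1_seq chi) //= orth // eqxx big_seq_cond big1; last first.
    by move=> psi /andP[psiX /negbTE]; rewrite orth // eq_sym => ->; rewrite mulr0.
  by rewrite addr0 mulrCA mulVf ?mulr1 // gt_eqF.
have conjS (b : 'I_q -> R[i]) : \sum_(r < q) b r * Num.conj (S r) =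
    phi^-1 * \sum_(chi <- X) Num.conj (c chi) * \sum_(r < q) b r * chi r.
  under [in RHS]eq_bigr do rewrite mulr_sumr.
  rewrite exchange_big /= mulr_sumr; apply: eq_bigr => r _.
  have -> : Num.conj (S r) = phi^-1 * \sum_(chi <- X) Num.conj (c chi) * chi r.
    rewrite /S rmorphM rmorph_sum /=; congr (_ * _); first by apply/CrealP; rewrite realV gtr0_real.
    by apply: eq_bigr => psi _; rewrite rmorphM /= conjCK.
  by rewrite mulrCA mulr_sumr; congr (_ * _); apply: eq_bigr => psi _; ring.
have E1 : \sum_(r < q) a r * Num.conj (S r) = T.
  by rewrite conjS /T; congr (_ * _); apply: eq_bigr => chi _; rewrite normCKC.
have E2 : \sum_(r < q) S r * Num.conj (S r) = T.
  rewrite conjS /T; congr (_ * _); apply: eq_big_seq => chi chiX.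
  by rewrite ScE // normCKC.
have E3 : \sum_(r < q) S r * Num.conj (a r) = T.
  have TR : Num.conj T = T.
    apply/CrealP/ger0_real/mulr_ge0; first by rewrite invr_ge0 ltW.
    by apply: sumr_ge0 => chi _; rewrite exprn_ge0.
  rewrite -TR -E1 rmorph_sum; apply: eq_bigr => r _.
  by rewrite rmorphM /= conjCK mulrC.
have pos : 0 <= \sum_(r < q) `|a r| ^+ 2 - T.
  suff -> : \sum_(r < q) `|a r| ^+ 2 - T = \sum_(r < q) `|a r - S r| ^+ 2.
    by apply: sumr_ge0 => r _; rewrite exprn_ge0.
  under [in RHS]eq_bigr => r _ do rewrite normCK rmorphB mulrBl !mulrBr -normCK.
  by rewrite !sumrB E1 E2 E3 subrr subr0.
rewrite -lecR rmorphM !rmorph_sum rmorph_nat /=.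
under eq_bigr do rewrite rmorphXn /= -cabsE.
under [in leRHS]eq_bigr do rewrite rmorphXn /= -cabsE.
apply: (@le_trans _ _ (phi * \sum_(r < q) `|a r| ^+ 2)); last first.
  by rewrite ler_wpM2r // sumr_ge0 // => r _; rewrite exprn_ge0.
by rewrite -ler_pdivrMl // -subr_ge0.
Qed.

(** Bessel's inequality for the indicator of the residue class of 1, where every character takes the
    value 1. *)
Lemma size_characters q (X : seq (nat -> R[i])) :
  uniq X -> (forall chi, chi \in X -> dirichlet_character q chi) ->
  (size X <= q)%N.
Proof.
case: X => [|chi0 X' uX XD] //; set X := chi0 :: X' in uX XD *.
have q0 : (0 < q)%N by case: (XD chi0 (mem_head _ _)).
(* The residue is 1 modulo q, which is 0 when q = 1. *)
pose i1 : 'I_q := Ordinal (ltn_pmod 1 q0).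
have := bessel (fun r => (r == i1)%:R) uX XD.
rewrite (bigD1 i1) //= eqxx cabs1 expr1n [X in 1 + X]big1 ?addr0 ?mulr1; last first.
  by move=> r ri; rewrite (negbTE ri) cabs0 expr0n.
rewrite (eq_big_seq (fun=> 1)); last first.
  move=> chi chiX; rewrite (bigD1 i1) //= eqxx mul1r big1 ?addr0; last first.
    by move=> r ri; rewrite (negbTE ri) mul0r.
  have [_ c1 _ per _] := XD _ chiX.
  by rewrite (char_mod _ per) c1 cabs1 expr1n.
by rewrite big_const_seq count_predT iter_addr_0 ler_nat.
Qed.

End Characters.

(** * Power sums and partial summation *)


Section PowerSums.
Variable R : realType.

Lemma powR_1B_le (t g : R) : 0 <= t <= 1 -> 0 <= g -> (1 - t) `^ g <= expR (- (t * g)).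
Proof.
move=> /andP[t0 t1] g0; rewrite -mulNr expRM ge0_ler_powR ?nnegrE ?subr_ge0 ?expR_ge0 //.
exact: expR_ge1Dx.
Qed.

Lemma powR_pred (k : nat) (g : R) : (0 < k)%N ->
  k.-1%:R `^ g = k%:R `^ g * (1 - k%:R^-1) `^ g.
Proof.
move=> k0; have kR : 0 < k%:R :> R by rewrite ltr0n.
rewrite -powRM ?subr_ge0 ?invf_le1 ?ler1n ?ler0n //.
by rewrite mulrBr mulr1 divff ?gt_eqF // -(natrB _ k0) subn1.
Qed.

Lemma powRB1 (k b : R) : 0 < k -> k `^ (b - 1) = k `^ b / k.
Proof.
by move=> k0; rewrite powRB ?powRr1 ?ltW //; apply/implyP => _; rewrite gt_eqF.
Qed.

(** The term k^(b-1) is compared with k^b - (k-1)^b, using (1 - 1/k)^b <= exp(-b/k) <= 1 - b/(2k);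
    the last inequality costs the factor 2. *)
Lemma sum_powR_le (b : R) (n : nat) : 0 < b <= 1 ->
  \sum_(1 <= k < n.+1) k%:R `^ (b - 1) <= 2 / b * n%:R `^ b.
Proof.
move=> /andP[b0 b1]; elim: n => [|n IH].
  by rewrite big_geq // mulr_ge0 ?powR_ge0 // divr_ge0 // ltW.
rewrite big_nat_recr //=; set k := n.+1%:R.
have k1 : 1 <= k by rewrite /k ler1n.
have k0 : 0 < k by rewrite ltr0n.
suff : k `^ (b - 1) <= 2 / b * k `^ b - 2 / b * n%:R `^ b by move: IH; lra.
have := @powR_pred n.+1 b isT; rewrite /= -/k => ->.
rewrite -(mulrBr (2 / b)) -{1}(mulr1 (k `^ b)) -(mulrBr (k `^ b)) powRB1 //.
have e1 := @powR_1B_le k^-1 b.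
have {e1} e1 : (1 - k^-1) `^ b <= expR (- (k^-1 * b)).
  apply: e1; last exact: ltW.
  by rewrite invr_ge0 (ltW k0) invf_le1.
set u := k^-1 * b in e1; have u0 : 0 < u by rewrite mulr_gt0 ?invr_gt0.
have u1 : u <= 1 by rewrite -[leRHS]mulr1 ler_pM ?invr_ge0 ?invf_le1 // ltW.
have e2 : expR (- u) <= 1 - u / 2.
  rewrite expRN; have := expR_ge1Dx u => e; rewrite invf_ple ?posrE ?expR_gt0 //; last by lra.
  apply: le_trans e; rewrite -[leLHS]mul1r ler_pdivrMr; last by lra.
  by nra.
have kb : 0 < k `^ b by rewrite powR_gt0.
apply: (@le_trans _ _ (2 / b * (k `^ b * (u / 2)))).
  by rewrite le_eqVlt; apply/orP; left; apply/eqP; rewrite /u; field; rewrite !gt_eqF.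
by rewrite ler_wpM2l ?divr_ge0 ?(ltW b0) // ler_wpM2l ?(ltW kb) //; lra.
Qed.

(** The term k^(-a) is compared with (k-1)^(1-a) - k^(1-a), by the Bernoulli-type inequality (1 -
    v)^(1-a) >= 1 + v(a - 1) at v = 1/k. *)
Lemma sum_powR_tail (a : R) (n m : nat) : 1 < a -> (0 < n)%N ->
  \sum_(n.+1 <= k < m) k%:R `^ (- a) <= n%:R `^ (1 - a) / (a - 1).
Proof.
move=> a1 n0; have a0 : 0 < a - 1 by lra.
case: (leqP m n.+1) => [mn|nm]; first by rewrite big_geq // divr_ge0 ?powR_ge0 // ltW.
rewrite ler_pdivlMr //.
apply: (@le_trans _ _ (n%:R `^ (1 - a) - m.-1%:R `^ (1 - a))); last first.
  by rewrite gerBl powR_ge0.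
rewrite -(opprB (m.-1%:R `^ (1 - a))).
have := @telescope_sumr _ n.+1 m (fun k => k.-1%:R `^ (1 - a)) (ltnW nm).
move=> /= <-; rewrite -sumrN mulr_suml big_nat_cond [leRHS]big_nat_cond.
apply: ler_sum => k /andP[/andP[nk _] _].
have k0 : (0 < k)%N by apply: leq_trans nk.
have k1 : 1 < k%:R :> R by rewrite ltr1n (leq_trans _ nk).
have kR : 0 < k%:R :> R by rewrite ltr0n.
have := @powR_pred k (1 - a) k0 => ->; rewrite opprB.
have -> : k%:R `^ (- a) = k%:R `^ (1 - a) * k%:R^-1.
  by rewrite -powRB1 //; congr (_ `^ _); ring.
have p0 : 0 < k%:R `^ (1 - a) by rewrite powR_gt0.
rewrite -mulrA -{3}(mulr1 (k%:R `^ (1 - a))) -(mulrBr (k%:R `^ (1 - a))) ler_wpM2l ?(ltW p0) //.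
have v0 : 0 < k%:R^-1 :> R by rewrite invr_gt0.
have v1 : k%:R^-1 < 1 :> R by rewrite invf_lt1.
set v := k%:R^-1 in v0 v1 *.
suff : 1 + v * (a - 1) <= (1 - v) `^ (1 - a) by lra.
rewrite (_ : 1 - a = - (a - 1)) ?powRN; last by ring.
apply: (@le_trans _ _ (expR (v * (a - 1)))); first exact: expR_ge1Dx.
rewrite -[X in expR X]opprK expRN lef_pV2 ?posrE ?expR_gt0 ?powR_gt0 ?subr_gt0 //.
by apply: powR_1B_le; rewrite ?(ltW v0) ?(ltW v1) ?ltW.
Qed.

(** The difference is at most (t/k) k^(-t), and t <= k^t because ln k >= 1. The bound does not
    depend on t, whence the uniformity in x later. *)
Lemma powR_diff_le (k : nat) (t : R) : (3 < k)%N -> 0 <= t ->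
  `|k.+1%:R `^ (- t) - k%:R `^ (- t)| <= k%:R^-1.
Proof.
move=> k3 t0; have k0 : (0 < k)%N by apply: leq_trans k3.
have kR : 0 < k%:R :> R by rewrite ltr0n.
have ln1 : 1 <= ln (k%:R : R).
  rewrite -[leLHS]expRK ler_ln ?posrE ?expR_gt0 //.
  (* From exp(-1/2) >= 1/2; squaring gives e <= 4 <= k. *)
  have h2 : expR (2^-1) <= 2 :> R.
    have := @expR_ge1Dx R (- 2^-1); rewrite expRN => h.
    have E0 : 0 < expR (2^-1 : R) by exact: expR_gt0.
    have := ler_wpM2l (ltW E0) h; rewrite divff ?gt_eqF //; lra.
  have -> : (1 : R) = 2^-1 + 2^-1 by field.
  rewrite expRD; apply: (@le_trans _ _ (2 * 2)); first by rewrite ler_pM ?expR_ge0.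
  have : (4 : R) <= k%:R by rewrite (ler_nat _ 4).
  lra.
have kt : t <= k%:R `^ t.
  rewrite /powR gt_eqF //; apply: le_trans (expR_ge1Dx _).
  have : t * 1 <= t * ln (k%:R : R) by rewrite ler_wpM2l.
  lra.
rewrite ler0_norm ?opprB; last first.
  by rewrite subr_le0 !powRN lef_pV2 ?posrE ?powR_gt0 ?ltr0n // ge0_ler_powR ?nnegrE ?ler_nat.
have -> : k.+1%:R `^ (- t) = k%:R `^ (- t) * (1 + k%:R^-1) `^ (- t) :> R.
  rewrite -powRM ?addr_ge0 ?invr_ge0 ?ler0n //.
  by rewrite mulrDr mulr1 divff ?gt_eqF // natr1.
have p0 : 0 < k%:R `^ t :> R by rewrite powR_gt0.
rewrite -{1}(mulr1 (k%:R `^ (- t))) -mulrBr powRN mulrC ler_pdivrMr //.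
have : 1 - t * k%:R^-1 <= (1 + k%:R^-1) `^ (- t) :> R.
  apply: le_trans (expR_ge1Dx _) _.
  rewrite mulrC -mulrN expRM powRN powRN lef_pV2 ?posrE ?powR_gt0 ?expR_gt0 ?addr_gt0 ?invr_gt0 //.
  by rewrite ge0_ler_powR ?nnegrE ?expR_ge0 ?addr_ge0 ?invr_ge0 ?ler0n // expR_ge1Dx.
move=> H; apply: (@le_trans _ _ (t * k%:R^-1)); first by lra.
by rewrite mulrC ler_wpM2l ?invr_ge0 ?ler0n.
Qed.

End PowerSums.

(** * Summation by parts *)

Section Abel.
Variable R : realType.
Implicit Types c : nat -> R[i].

Lemma abel_bound c (w : nat -> R) (B : R) u v :
  (forall k, 0 <= w k) -> (forall k, (u <= k)%N -> w k.+1 <= w k) ->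
  (forall v, cabs (\sum_(u <= k < v) c k) <= B) ->
  cabs (\sum_(u <= k < v) c k * (w k)%:C) <= B * w u.
Proof.
move=> w0 wd cB; have B0 : 0 <= B by apply: le_trans (cB 0%N); apply: cabs_ge0.
case: (leqP v u) => [vu|/ltnW uv].
  by rewrite big_geq // cabs0 mulr_ge0.
pose C v := \sum_(u <= k < v) c k.
have -> : \sum_(u <= k < v) c k * (w k)%:C =
    C v * (w v)%:C + \sum_(u <= k < v) C k.+1 * (w k - w k.+1)%:C.
  have -> : C v * (w v)%:C = \sum_(u <= k < v) (C k.+1 * (w k.+1)%:C - C k * (w k)%:C).
    by rewrite (telescope_sumr (fun k => C k * (w k)%:C) uv) /= {3}/C big_geq // mul0r subr0.
  rewrite -big_split /= big_nat_cond [RHS]big_nat_cond; apply: eq_bigr => k /andP[/andP[uk _] _].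
  by rewrite {1 3}/C big_nat_recr //= -/(C k) rmorphB /=; ring.
rewrite (le_trans (cabsD _ _)) // cabsM cabsR ger0_norm //.
apply: (@le_trans _ _ (B * w v + \sum_(u <= k < v) B * (w k - w k.+1))).
  apply: lerD; first by rewrite ler_wpM2r ?cB.
  rewrite (le_trans (cabs_sum _ _ _)) // big_nat_cond [leRHS]big_nat_cond.
  apply: ler_sum => k /andP[/andP[uk _] _].
  by rewrite cabsM cabsR ger0_norm ?subr_ge0 ?wd // ler_wpM2r ?subr_ge0 ?wd //; exact: cB.
rewrite -mulr_sumr -mulrDr ler_wpM2l //.
have -> : \sum_(u <= k < v) (w k - w k.+1) = w u - w v.
  by rewrite -opprB -(telescope_sumr w uv) -sumrN; apply: eq_bigr => k _; rewrite opprB.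
by rewrite addrC subrK.
Qed.

(** Here the sums run to the right end: the tail beyond k has a mean that decays with k, which makes
    the weighted sum of tails small, while initial segments would not decay. *)
Lemma abel_tail_bound c (w : nat -> R) u v : (u <= v)%N ->
  cabs (\sum_(u <= k < v) c k * (w k)%:C) <=
    cabs (\sum_(u <= k < v) c k) * `|w u| +
    \sum_(u <= k < v) cabs (\sum_(k.+1 <= l < v) c l) * `|w k.+1 - w k|.
Proof.
move=> uv; pose T n := \sum_(n <= l < v) c l.
have -> : \sum_(u <= k < v) c k * (w k)%:C =
    T u * (w u)%:C + \sum_(u <= k < v) T k.+1 * (w k.+1 - w k)%:C.
  have -> : T u * (w u)%:C = - \sum_(u <= k < v) (T k.+1 * (w k.+1)%:C - T k * (w k)%:C).
    have Tv : T v = 0 by rewrite /T big_geq.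
    by rewrite (telescope_sumr (fun k => T k * (w k)%:C) uv) /= Tv mul0r sub0r opprK.
  rewrite -sumrN -big_split /= big_nat_cond [RHS]big_nat_cond; apply: eq_bigr => k /andP[/andP[_ kv] _].
  by rewrite {2}/T big_ltn //= -/(T k.+1) rmorphB /=; ring.
rewrite (le_trans (cabsD _ _)) // cabsM cabsR lerD2l (le_trans (cabs_sum _ _ _)) //.
by apply: ler_sum => k _; rewrite cabsM cabsR.
Qed.

End Abel.

(** * L-values and sums over rough numbers *)


Section LSeries.
Variable R : realType.
Implicit Types (chi : nat -> R[i]) (q : nat) (x : R).

Lemma powRD_gt0 (k a b : R) : 0 < k -> k `^ (a + b) = k `^ a * k `^ b.
Proof. by move=> k0; apply: powRD; rewrite (gt_eqF k0) implybT. Qed.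

Definition lterm chi x n : R[i] := chi n / (n%:R `^ x)%:C.

Lemma ltermE chi x n : lterm chi x n = chi n * (n%:R `^ (- x))%:C.
Proof. by rewrite /lterm powRN -fmorphV. Qed.

Lemma powRN_homo x (m n : nat) : 0 <= x -> (0 < m)%N -> (m <= n)%N ->
  n%:R `^ (- x) <= m%:R `^ (- x) :> R.
Proof.
move=> x0 m0 mn; have n0 := leq_trans m0 mn.
by rewrite !powRN lef_pV2 ?posrE ?powR_gt0 ?ltr0n // ge0_ler_powR ?nnegrE ?ler_nat ?ler0n.
Qed.

Definition lsum chi x u : R[i] := \sum_(1 <= n < u.+1) lterm chi x n.

Lemma lsumB chi x n m : (n <= m)%N ->
  lsum chi x m - lsum chi x n = \sum_(n.+1 <= k < m.+1) lterm chi x k.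
Proof.
by move=> nm; rewrite /lsum (@big_cat_nat _ _ _ n.+1) //= addrAC subrr add0r.
Qed.

Lemma lsum_tail q chi x n m : nonprincipal q chi -> 0 <= x -> (n <= m)%N ->
  cabs (lsum chi x m - lsum chi x n) <= q%:R * n.+1%:R `^ (- x).
Proof.
move=> np x0 nm; rewrite lsumB //; under eq_bigr do rewrite ltermE.
apply: (@abel_bound R chi (fun k => k%:R `^ (- x))).
- by move=> k; apply: powR_ge0.
- by move=> k nk; apply: powRN_homo => //; apply: leq_trans nk.
- by move=> v; apply: char_partial_sum.
Qed.

(** Records the values of L(., chi) on [s, +oo[ together with the rate of convergence of the
    Dirichlet series, from which continuity, the limit at +oo and the truncation estimates are all
    derived. *)
Definition lvalue_rate q chi (s : R) (L : R -> R[i]) : Prop :=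
  forall x, s <= x -> forall u,
    cabs (L x - lsum chi x u) <= 2 * (q%:R * u.+1%:R `^ (- x)).

Lemma lvalue_exists q chi (s : R) : nonprincipal q chi -> 0 <= s ->
  exists L : R -> R[i], lvalue_rate q chi s L.
Proof.
move=> np s0; have [x|L HL] := @choice R R[i] (fun x l => s <= x -> forall u,
    cabs (l - lsum chi x u) <= 2 * (q%:R * u.+1%:R `^ (- x))); last by exists L.
(* Below s nothing is required, and 0 is a default value. *)
have [sx|] := boolP (s <= x); last by exists 0.
have [l Hl] := complex_rate_limit (fun n m => lsum_tail np (le_trans s0 sx) (n := n) (m := m)).
by exists l.
Qed.

Lemma cvg_powRN x : 0 < x -> (fun u : nat => u.+1%:R `^ (- x)) @ \oo --> (0 : R).
Proof.
move=> x0; apply/cvgrPdist_lt => e e0.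
exists (Num.truncn (e^-1 `^ x^-1)).+1 => //= n /= Nn.
rewrite sub0r normrN ger0_norm ?powR_ge0 // powRN -[ltRHS]invrK ltf_pV2 ?posrE ?powR_gt0 ?invr_gt0 ?ltr0n //.
have -> : e^-1 = (e^-1 `^ x^-1) `^ x.
  by rewrite -powRrM mulVf ?gt_eqF // powRr1 // invr_ge0 ltW.
rewrite gt0_ltr_powR ?nnegrE ?powR_ge0 ?ler0n //.
apply: lt_le_trans (truncnS_gt _) _.
by rewrite ler_nat (leq_trans Nn).
Qed.

Lemma dirichlet_L_lvalue q chi (s : R) L x : nonprincipal q chi ->
  lvalue_rate q chi s L -> 0 < x -> s <= x -> dirichlet_L q chi x (L x).
Proof.
move=> np HL x0 sx; rewrite /dirichlet_L.
(* The sum of chi over a period is 0, so the correction term in [dirichlet_L] vanishes. *)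
have := char_window 0 np; rewrite add0n big_mkord => ->.
apply: (@cvg_rate _ _ (fun u => (2 * q%:R) * u.+1%:R `^ (- x))).
  move=> u; rewrite mul0r mul0r subr0 -mulrA; exact: HL.
by rewrite -(mulr0 (2 * q%:R)); apply: cvgMr; apply: cvg_powRN.
Qed.

(** All u must be covered, since sieving replaces u by u/p repeatedly. For u + 1 >= q the
    cancellation in character sums suffices; for smaller u the terms up to q are summed trivially,
    and q^th pays for (u+1)^(-th). *)
Lemma lvalue_tail_le q chi (s b th : R) L x u : dirichlet_character q chi ->
  lvalue_rate q chi s L -> s <= x -> 0 < b <= 1 -> 0 <= th -> 1 - s + th = b ->
  th <= s -> 1 - s <= b ->
  cabs (L x - lsum chi x u) <=
    (2 + 2 / b) * q%:R `^ (th + b) * u.+1%:R `^ (- th).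
Proof.
move=> chiD HL sx /andP[b0 b1] th0 sb ths s1b.
have q0 : (0 < q)%N by case: chiD.
have qR : 1 <= q%:R :> R by rewrite ler1n.
have qR0 : 0 < q%:R :> R by rewrite ltr0n.
have s0 : 0 <= s by apply: le_trans ths.
have x0 : 0 <= x by apply: le_trans sx.
have uR : 0 < u.+1%:R :> R by rewrite ltr0n.
have xs n : (0 < n)%N -> n%:R `^ (- x) <= n%:R `^ (- s) :> R.
  by move=> n0; rewrite ler_powR ?ler1n // lerN2.
have qb1 : q%:R `^ b <= q%:R `^ (th + b) :> R by rewrite ler_powR // lerDr.
have c0 : 0 < 2 + 2 / b by rewrite addr_gt0 // divr_gt0.
case: (leqP q u.+1) => qu.
  apply: le_trans (HL _ sx _) _; rewrite mulrA.
  apply: (@le_trans _ _ (2 * q%:R * (u.+1%:R `^ (- th) * q%:R `^ (th - s)))).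
    rewrite ler_wpM2l ?mulr_ge0 //; apply: le_trans (xs _ _) _ => //.
    have -> : u.+1%:R `^ (- s) = u.+1%:R `^ (- th) * u.+1%:R `^ (th - s) :> R.
      by rewrite -powRD_gt0 //; congr (_ `^ _); ring.
    rewrite ler_wpM2l ?powR_ge0 //.
    by have := @powRN_homo (s - th) q u.+1; rewrite opprB; apply; rewrite ?subr_ge0.
  have -> : 2 * q%:R * (u.+1%:R `^ (- th) * q%:R `^ (th - s)) =
      2 * q%:R `^ b * u.+1%:R `^ (- th).
    have -> : q%:R `^ b = q%:R `^ (th - s) * q%:R.
      rewrite -[X in _ * X](powRr1 (ltW qR0)) -powRD_gt0 //.
      by congr (_ `^ _); rewrite -sb; ring.
    ring.
  rewrite ler_wpM2r ?powR_ge0 // ler_pM ?powR_ge0 //.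
  by rewrite lerDl divr_ge0 // ltW.
apply: (@le_trans _ _ ((2 + 2 / b) * q%:R `^ b)); last first.
  rewrite powRD_gt0 // -!mulrA ler_wpM2l ?(ltW c0) //.
  rewrite mulrCA -[leLHS]mulr1 ler_wpM2l ?powR_ge0 // powRN ler_pdivlMr ?powR_gt0 // mul1r.
  by rewrite ge0_ler_powR ?nnegrE ?ler0n // ler_nat ltnW.
apply: le_trans (cabs_dist _ (lsum chi x q) _) _; rewrite mulrDl lerD //.
  apply: le_trans (HL _ sx _) _; rewrite ler_wpM2l //.
  apply: (@le_trans _ _ (q%:R * q%:R `^ (- s))).
    rewrite ler_wpM2l ?ler0n //; apply: le_trans (xs _ _) _ => //.
    exact: powRN_homo.
  rewrite -{1}(powRr1 (ltW qR0)) -powRD_gt0 //.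
  by rewrite ler_powR.
rewrite lsumB; last by apply: ltnW; apply: leq_trans qu.
apply: le_trans (cabs_sum _ _ _) _.
apply: (@le_trans _ _ (\sum_(1 <= k < q.+1) k%:R `^ (b - 1))); last first.
  by apply: sum_powR_le; rewrite b0.
rewrite [leRHS](@big_cat_nat _ _ _ u.+1) //=; last by apply: ltnW; apply: leq_trans qu _.
rewrite -[leLHS]add0r lerD //.
  by apply: sumr_ge0 => k _; apply: powR_ge0.
rewrite big_nat_cond [leRHS]big_nat_cond; apply: ler_sum => k /andP[/andP[uk _] _].
have k0 : (0 < k)%N by apply: leq_trans uk.
rewrite ltermE cabsM cabsR ger0_norm ?powR_ge0 // -[leRHS]mul1r.
apply: ler_pM; rewrite ?cabs_ge0 ?powR_ge0 // ?(cabs_char _ chiD) //.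
by rewrite ler_powR ?ler1n //; lra.
Qed.

End LSeries.

(** * Sieving the Dirichlet series by small primes *)

Section RoughSums.
Variable R : realType.
Implicit Types (chi : nat -> R[i]) (q : nat) (x : R).

Definition coprime_to (ps : seq nat) (n : nat) := all (fun p => ~~ (p %| n)%N) ps.

Definition rsum chi (ps : seq nat) x u : R[i] :=
  \sum_(1 <= n < u.+1 | coprime_to ps n) lterm chi x n.

Lemma sum_multiples (V : nmodType) (F : nat -> V) (P : pred nat) p u : (0 < p)%N ->
  \sum_(1 <= n < u.+1 | (p %| n)%N && P n) F n =
  \sum_(1 <= m < (u %/ p)%N.+1 | P (p * m)%N) F (p * m)%N.
Proof.
move=> p0; elim: u => [|u IH]; first by rewrite div0n !big_geq.
rewrite big_mkcond big_nat_recr //= -big_mkcond IH divnS //.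
case: (boolP (p %| u.+1)%N) => pu /=; last by rewrite add0n addr0.
rewrite add1n [RHS]big_mkcond [in RHS]big_nat_recr //= -big_mkcond.
have -> : (p * (u %/ p).+1)%N = u.+1; last by [].
have := divnS u p0; rewrite pu add1n => <-.
by rewrite mulnC divnK.
Qed.

(** One step of Legendre's sieve: the multiples of p that survive [ps] are the p m with m surviving
    [ps], because p is a prime outside [ps]. *)
Lemma rsum_cons q chi (ps : seq nat) p x u : dirichlet_character q chi ->
  prime p -> p \notin ps -> all prime ps ->
  rsum chi (p :: ps) x u =
    rsum chi ps x u - lterm chi x p * rsum chi ps x (u %/ p)%N.
Proof.
move=> chiD pp pps psP; apply/eqP; rewrite -subr_eq opprK; apply/eqP.
rewrite [LHS]addrC [RHS](bigID (fun n => p %| n)%N) /=; congr (_ + _); last first.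
  by rewrite /rsum; apply: eq_bigl => n; rewrite /= andbC.
under [RHS]eq_bigl do rewrite andbC.
rewrite sum_multiples ?prime_gt0 // /rsum mulr_sumr.
have cE m : coprime_to ps (p * m)%N = coprime_to ps m.
  apply: eq_in_all => p' p'ps; rewrite Euclid_dvdM ?(allP psP) //.
  rewrite dvdn_prime2 ?(allP psP _ p'ps) //.
  by have -> : (p' == p) = false by apply/negbTE; apply: contraNneq pps => E; move: p'ps; rewrite E.
apply: eq_big => [m|m _]; first by rewrite cE.
rewrite /lterm; case: chiD => _ _ cM _ _.
rewrite cM natrM powRM ?ler0n // rmorphM invfM; ring.
Qed.

(* The bound is in terms of u.+1 because (u %/ p).+1 >= u.+1 / p, so that each new
   prime only costs a factor 1 + p^(th - x). *)
Lemma rough_error q chi (L : R[i]) x th B ps u : dirichlet_character q chi ->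
  0 <= th -> (forall u, cabs (L - lsum chi x u) <= B * u.+1%:R `^ (- th)) ->
  uniq ps -> all prime ps ->
  cabs ((\prod_(p <- ps) (1 - lterm chi x p)) * L - rsum chi ps x u) <=
    B * expR (\sum_(p <- ps) p%:R `^ (th - x)) * u.+1%:R `^ (- th).
Proof.
move=> chiD th0 HL.
have B0 : 0 <= B.
  have := HL 0%N; rewrite powR1 mulr1; exact: le_trans (cabs_ge0 _).
elim: ps u => [|p ps IH] u.
  move=> _ _; rewrite !big_nil mul1r expR0 mulr1.
  suff -> : rsum chi [::] x u = lsum chi x u by apply: HL.
  exact: eq_bigl.
move=> /= /andP[pps ups] /andP[pp psP].
have pR : 0 < p%:R :> R by rewrite ltr0n prime_gt0.
rewrite (rsum_cons _ _ chiD pp pps psP) !big_cons.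
set P := \prod_(_ <- _) _; set r := rsum chi ps x u; set r' := rsum chi ps x _.
have -> : (1 - lterm chi x p) * P * L - (r - lterm chi x p * r') =
   (P * L - r) - lterm chi x p * (P * L - r') by ring.
apply: le_trans (cabsBD _ _) _.
set e := \sum_(_ <- _) _ in IH *; set E := B * expR e in IH.
have E0 : 0 <= E by rewrite mulr_ge0 ?expR_ge0.
apply: (@le_trans _ _ (E * u.+1%:R `^ (- th) + p%:R `^ (th - x) * (E * u.+1%:R `^ (- th)))).
  apply: lerD; first exact: IH.
  rewrite cabsM ltermE cabsM cabsR ger0_norm ?powR_ge0 //.
  apply: (@le_trans _ _ (p%:R `^ (- x) * (E * (u %/ p)%N.+1%:R `^ (- th)))).
    apply: ler_pM; rewrite ?mulr_ge0 ?cabs_ge0 ?powR_ge0 //; last exact: IH.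
    by rewrite -[leRHS]mul1r ler_wpM2r ?powR_ge0 // (cabs_char _ chiD).
  have -> : th - x = - x + th by ring.
  rewrite powRD_gt0 // -mulrA ler_wpM2l ?powR_ge0 // mulrCA ler_wpM2l //.
  rewrite !powRN ler_pdivlMr ?powR_gt0 ?ltr0n // mulrC ler_pdivrMr ?powR_gt0 ?ltr0n //.
  rewrite -powRM ?ler0n // ge0_ler_powR ?nnegrE ?mulr_ge0 ?ler0n // -natrM ler_nat.
  by rewrite mulnC ltn_ceil // prime_gt0.
rewrite -{1}[E * _]mul1r -mulrDl [leRHS](_ : _ = expR (p%:R `^ (th - x)) * (E * u.+1%:R `^ (- th))).
  by rewrite ler_wpM2r ?mulr_ge0 ?powR_ge0 // expR_ge1Dx.
by rewrite expRD /E; ring.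
Qed.

End RoughSums.

(** * First moments over characters *)


Section Moments.
Variable R : realType.
Implicit Types (chi : nat -> R[i]) (q : nat) (X : seq (nat -> R[i])).

Lemma sum_blocks (V : nmodType) (F : nat -> V) (m q : nat) :
  \sum_(0 <= k < m * q) F k = \sum_(0 <= j < m) \sum_(r < q) F (j * q + r)%N.
Proof.
elim: m => [|m IH]; first by rewrite mul0n !big_geq.
rewrite big_nat_recr //= -IH (@big_cat_nat _ _ _ (m * q)%N) ?leq_mul2r ?leqnSn ?orbT //=.
congr (_ + _); rewrite -{1}(add0n (m * q)%N) big_addn mulSn addnK big_mkord.
by apply: eq_bigr => r _; rewrite addnC.
Qed.

Lemma block_moment q X (a : nat -> R) (j : nat) (t : R) :
  uniq X -> (forall chi, chi \in X -> dirichlet_character q chi) -> 0 < t ->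
  \sum_(r < q) a (j * q + r)%N ^+ 2 <= t ^+ 2 ->
  \sum_(chi <- X) cabs (\sum_(r < q) (a (j * q + r)%N)%:C * chi (j * q + r)%N) <= q%:R * t.
Proof.
move=> uX XD t0 at2.
pose S chi : R[i] := \sum_(r < q) (a (j * q + r)%N)%:C * chi r.
have -> : \sum_(chi <- X) cabs (\sum_(r < q) (a (j * q + r)%N)%:C * chi (j * q + r)%N) =
    \sum_(chi <- X) cabs (S chi).
  apply: eq_big_seq => chi chiX; congr cabs; apply: eq_bigr => r _.
  have [_ _ _ per _] := XD _ chiX.
  by rewrite -(char_mod _ per) modnMDl (char_mod _ per).
have b := bessel (fun r : 'I_q => (a (j * q + r)%N)%:C) uX XD; rewrite -/S in b.
have sz : (size X)%:R <= q%:R :> R by rewrite ler_nat (size_characters uX XD).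
(* AM-GM in place of Cauchy-Schwarz: [c <= c^2 / (2 t) + t / 2] *)
apply: (@le_trans _ _ (\sum_(chi <- X) (cabs (S chi) ^+ 2 / (2 * t) + t / 2))).
  apply: ler_sum => chi _; set c := cabs _.
  rewrite -subr_ge0 (_ : _ - _ = (c - t) ^+ 2 / (2 * t)); last by field; rewrite gt_eqF.
  by rewrite divr_ge0 ?sqr_ge0 // mulr_ge0 // ltW.
rewrite big_split /= -mulr_suml.
rewrite [X in _ + X](_ : _ = (size X)%:R * (t / 2)); last first.
  by rewrite big_const_seq count_predT iter_addr_0 mulr_natl.
have -> : q%:R * t = q%:R * t ^+ 2 / (2 * t) + q%:R * (t / 2) by field; rewrite gt_eqF.
apply: lerD; last by rewrite ler_wpM2r // divr_ge0 // ltW.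
rewrite ler_wpM2r ?invr_ge0 ?mulr_ge0 ?(ltW t0) //.
apply: le_trans b _; rewrite ler_wpM2l ?ler0n //; apply: le_trans at2.
by apply: ler_sum => r _; rewrite cabsR real_normK ?num_real.
Qed.

Lemma powR_sqr (k x : R) : 0 < k -> (k `^ x) ^+ 2 = k `^ (x * 2).
Proof. by move=> k0; rewrite powRrM -[2]/(2%:R) powR_mulrn ?powR_ge0. Qed.

Lemma tail_moment q X (a : nat -> R) (s : R) (N m : nat) :
  uniq X -> (forall chi, chi \in X -> dirichlet_character q chi) ->
  3 / 4 <= s -> (0 < N)%N ->
  (forall k, 0 <= a k) -> (forall k, (0 < k)%N -> a k <= k%:R `^ (- s)) ->
  \sum_(chi <- X) cabs (\sum_(N.+1 <= k < m) (a k)%:C * chi k) <=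
  q%:R * (2 * N%:R `^ (2^-1 - s) + q%:R `^ (2^-1 - s) * \sum_(1 <= j < m) j%:R `^ (- s)).
Proof.
move=> uX XD s34 N0 a0 ak.
have [->|Xn] := eqVneq X [::].
  rewrite big_nil mulr_ge0 ?ler0n // addr_ge0 ?mulr_ge0 ?powR_ge0 //.
  by apply: sumr_ge0 => j _; apply: powR_ge0.
have q0 : (0 < q)%N.
  by case: X Xn XD {uX} => // chi X' _ /(_ chi (mem_head _ _))[].
have qR : 0 < q%:R :> R by rewrite ltr0n.
have NR : 0 < N%:R :> R by rewrite ltr0n.
(* Extension by 0, so that the range is made of whole blocks of length q. *)
pose b k := if (N < k < m)%N then a k else 0.
have b0 k : 0 <= b k by rewrite /b; case: ifP.
have bk k : (0 < k)%N -> b k <= k%:R `^ (- s).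
  by move=> k0; rewrite /b; case: ifP => _; rewrite ?ak ?powR_ge0.
have sumE chi : \sum_(N.+1 <= k < m) (a k)%:C * chi k =
    \sum_(0 <= j < m) \sum_(r < q) (b (j * q + r)%N)%:C * chi (j * q + r)%N.
  rewrite -(sum_blocks (fun k => (b k)%:C * chi k)).
  have mq : (m <= m * q)%N by rewrite leq_pmulr.
  rewrite [RHS](@big_cat_nat _ _ _ m) //= [X in _ = _ + X]big_nat_cond [X in _ = _ + X]big1 ?addr0; last first.
    by move=> k /andP[/andP[mk _] _]; rewrite /b [(k < m)%N]ltnNge mk andbF mul0r.
  case: (leqP m N.+1) => [mN|/ltnW Nm].
    rewrite big_geq // big_nat_cond big1 // => k /andP[/andP[_ km] _].
    by rewrite /b ltnNge -ltnS (leq_trans km mN) mul0r.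
  rewrite [RHS](@big_cat_nat _ _ _ N.+1) //= [X in _ = X + _]big_nat_cond [X in _ = X + _]big1 ?add0r; last first.
    by move=> k /andP[/andP[_ kN] _]; rewrite /b ltnNge -ltnS kN mul0r.
  rewrite big_nat_cond [RHS]big_nat_cond; apply: eq_bigr => k /andP[/andP[Nk km] _].
  by rewrite /b Nk km.
apply: (@le_trans _ _ (\sum_(0 <= j < m) \sum_(chi <- X)
    cabs (\sum_(r < q) (b (j * q + r)%N)%:C * chi (j * q + r)%N))).
  rewrite exchange_big /=; apply: ler_sum => chi _; rewrite sumE; exact: cabs_sum.
(* Block 0 gives the main term N^(1/2 - s); the constant is safe because 2s - 1 >= 1/2. In block j
   >= 1 each of the q coefficients is at most (j q)^(-s). *)
have first_block : \sum_(r < q) b (0 * q + r)%N ^+ 2 <= (2 * N%:R `^ (2^-1 - s)) ^+ 2.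
  apply: (@le_trans _ _ (\sum_(N.+1 <= k < q) k%:R `^ (- (s * 2)))).
    rewrite -(big_mkord xpredT (fun r => b (0 * q + r)%N ^+ 2)).
    have bz k : (k < N.+1)%N -> b (0 * q + k)%N ^+ 2 = 0.
      by move=> kN; rewrite /b mul0n add0n ltnNge -ltnS kN expr0n.
    case: (leqP q N.+1) => [qN|/ltnW Nq].
      by rewrite [leRHS]big_geq // big_nat_cond big1 // => k /andP[/andP[_ kq] _]; rewrite bz // (leq_trans kq).
    rewrite (@big_cat_nat _ _ _ N.+1) //= big_nat_cond big1 ?add0r; last first.
      by move=> k /andP[/andP[_ kq] _]; rewrite bz.
    rewrite big_nat_cond [leRHS]big_nat_cond; apply: ler_sum => k /andP[/andP[Nk _] _].
    have k0 : (0 < k)%N by apply: leq_trans Nk.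
    rewrite mul0n add0n -mulNr -powR_sqr ?ltr0n //.
    by rewrite lerXn2r ?nnegrE ?powR_ge0 // bk.
  apply: le_trans (sum_powR_tail _ _ N0) _; first by lra.
  rewrite exprMn powR_sqr // (_ : (2^-1 - s) * 2 = 1 - s * 2); last by field.
  rewrite mulrC ler_wpM2r ?powR_ge0 //.
  rewrite invf_ple ?posrE; [|lra|lra].
  by have : (2 ^+ 2)^-1 <= 2^-1 :> R; [rewrite lef_pV2 ?posrE ?exprn_gt0 //; lra|lra].
have other_block j : (0 < j)%N -> \sum_(r < q) b (j * q + r)%N ^+ 2 <=
    (q%:R `^ 2^-1 * (j * q)%:R `^ (- s)) ^+ 2.
  move=> j0; rewrite exprMn powR_sqr // mulVf ?pnatr_eq0 // powRr1 ?ler0n //.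
  rewrite -[X in X%:R * _](card_ord q) mulr_natl -sumr_const; apply: ler_sum => r _.
  rewrite lerXn2r ?nnegrE ?powR_ge0 //; apply: le_trans (bk _ _) _; first by rewrite addn_gt0 muln_gt0 j0 q0.
  by apply: powRN_homo; [lra|rewrite muln_gt0 j0|exact: leq_addr].
case: m @b b0 bk sumE first_block other_block => [|m] b b0 bk sumE first_block other_block.
  rewrite !big_geq // mulr_ge0 // mulr0 addr0 mulr_ge0 // powR_ge0 //.
rewrite big_ltn // mulrDr lerD //.
  by apply: block_moment => //; rewrite mulr_gt0 // powR_gt0.
rewrite !mulr_sumr big_nat_cond [leRHS]big_nat_cond; apply: ler_sum => j /andP[/andP[j0 _] _].
apply: le_trans (block_moment uX XD _ (other_block j j0)) _.
  by rewrite mulr_gt0 // powR_gt0 // ltr0n muln_gt0 j0.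
rewrite ler_wpM2l ?ler0n // natrM powRM ?ler0n // powRD_gt0 //.
by rewrite mulrCA mulrC.
Qed.

Definition rough_tail chi (ps : seq nat) (s : R) (n m : nat) : R[i] :=
  \sum_(n <= k < m | coprime_to ps k) lterm chi s k.

(* The weights come from |k.+1^(s - x) - k^(s - x)| <= 1/k, which holds for all
   x >= s, so that the majorant does not depend on x. *)
Definition rough_majorant chi (ps : seq nat) (s : R) (Y m : nat) : R :=
  cabs (rough_tail chi ps s Y.+1 m) +
  \sum_(Y.+1 <= k < m) cabs (rough_tail chi ps s k.+1 m) * k%:R^-1.

Lemma rough_tail_moment q X ps (s : R) (N m : nat) :
  uniq X -> (forall chi, chi \in X -> dirichlet_character q chi) ->
  3 / 4 <= s -> (0 < N)%N ->
  \sum_(chi <- X) cabs (rough_tail chi ps s N.+1 m) <=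
  q%:R * (2 * N%:R `^ (2^-1 - s) + q%:R `^ (2^-1 - s) * \sum_(1 <= j < m) j%:R `^ (- s)).
Proof.
move=> uX XD s34 N0.
pose a k := (coprime_to ps k)%:R * k%:R `^ (- s) : R.
apply: le_trans (@tail_moment q X a s N m uX XD s34 N0 _ _).
- apply: ler_sum => chi _; rewrite le_eqVlt; apply/orP; left; apply/eqP; congr cabs.
  rewrite /rough_tail big_mkcond; apply: eq_bigr => k _; rewrite ltermE /a.
  by case: coprime_to; rewrite /= ?mul1r ?mul0r ?rmorph0 ?mul0r // mulrC.
- by move=> k; rewrite mulr_ge0 ?powR_ge0.
- by move=> k _; rewrite ler_piMl ?powR_ge0 // lern1; case: coprime_to.
Qed.

(** Constants: 10 = 2 + 2 * 4, from the leading tail and from the sum of the others; 3164 = 28 *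
    113, where 28 K^(1/14) bounds the sum of j^(-s) and 113 K^(1/56) bounds 1 plus the harmonic sum.
    The exponent -3/7 is 1/2 - 13/14. *)
Lemma rough_majorant_moment q X ps (s : R) (Y K : nat) :
  uniq X -> (forall chi, chi \in X -> dirichlet_character q chi) ->
  13 / 14 <= s -> (0 < Y)%N -> (0 < q)%N -> (0 < K)%N ->
  \sum_(chi <- X) rough_majorant chi ps s Y K.+1 <=
  q%:R * (10 * Y%:R `^ (2^-1 - s) + 3164 * (q%:R `^ (- (3 / 7)) * K%:R `^ (5 / 56))).
Proof.
move=> uX XD s14 Y0 q0 K0.
have s34 : 3 / 4 <= s by lra.
have KR : 1 <= K%:R :> R by rewrite ler1n.
have YR : 0 < Y%:R :> R by rewrite ltr0n.
set D := q%:R `^ (2^-1 - s) * \sum_(1 <= j < K.+1) j%:R `^ (- s).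
have D0 : 0 <= D by rewrite mulr_ge0 ?powR_ge0 // sumr_ge0 // => j _; apply: powR_ge0.
have M N : (0 < N)%N -> \sum_(chi <- X) cabs (rough_tail chi ps s N.+1 K.+1) <=
    q%:R * (2 * N%:R `^ (2^-1 - s) + D).
  by move=> N0; apply: rough_tail_moment.
apply: (@le_trans _ _ (q%:R * (10 * Y%:R `^ (2^-1 - s) +
    D * (1 + \sum_(1 <= k < K.+1) k%:R^-1)))).
  rewrite /rough_majorant big_split /= exchange_big /=.
  apply: (@le_trans _ _ (q%:R * (2 * Y%:R `^ (2^-1 - s) + D) +
     \sum_(Y.+1 <= k < K.+1) q%:R * (2 * k%:R `^ (- (s + 2^-1)) + D * k%:R^-1))).
    apply: lerD; first exact: M.
    rewrite big_nat_cond [leRHS]big_nat_cond; apply: ler_sum => k /andP[/andP[Yk _] _].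
    have k0 : (0 < k)%N by apply: leq_trans Yk.
    rewrite -mulr_suml ler_pdivrMr ?ltr0n //; apply: le_trans (M k k0) _.
    rewrite -mulrA ler_wpM2l ?ler0n //.
    rewrite (_ : - (s + 2^-1) = 2^-1 - s - 1); last by field.
    rewrite powRB1 ?ltr0n // le_eqVlt; apply/orP; left; apply/eqP.
    by field; rewrite pnatr_eq0 -lt0n.
  rewrite -mulr_sumr -mulrDr ler_wpM2l ?ler0n // big_split /= -!mulr_sumr mulrDr mulr1.
  have T : \sum_(Y.+1 <= k < K.+1) k%:R `^ (- (s + 2^-1)) <= 4 * Y%:R `^ (2^-1 - s).
    apply: le_trans (sum_powR_tail _ _ Y0) _; first by lra.
    rewrite (_ : 1 - (s + 2^-1) = 2^-1 - s); last by field.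
    rewrite mulrC ler_wpM2r ?powR_ge0 // invf_ple ?posrE; [lra|lra|lra].
  have S : D * (\sum_(Y.+1 <= k < K.+1) k%:R^-1) <= D * (\sum_(1 <= k < K.+1) k%:R^-1).
    rewrite ler_wpM2l //; case: (leqP Y K) => YK; last first.
      by rewrite big_geq ?ltnS ?(ltnW YK) // sumr_ge0 // => k _; rewrite invr_ge0.
    rewrite [leRHS](@big_cat_nat _ _ _ Y.+1) //= lerDr; apply: sumr_ge0 => k _.
    by rewrite invr_ge0 ler0n.
  have P := powR_ge0 Y%:R (2^-1 - s).
  lra.
rewrite ler_wpM2l ?ler0n // lerD2l.
have S1 : \sum_(1 <= j < K.+1) j%:R `^ (- s) <= 28 * K%:R `^ (1 / 14).
  have : \sum_(1 <= j < K.+1) j%:R `^ (1 / 14 - 1) <= 2 / (1 / 14) * K%:R `^ (1 / 14) :> R.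
    by apply: sum_powR_le; lra.
  rewrite (_ : 2 / (1 / 14) = 28); last by field.
  apply: le_trans; rewrite big_nat_cond [leRHS]big_nat_cond.
  apply: ler_sum => k /andP[/andP[k0 _] _]; rewrite ler_powR ?ler1n //; lra.
have S2 : 1 + \sum_(1 <= j < K.+1) j%:R^-1 <= 113 * K%:R `^ (1 / 56) :> R.
  have : \sum_(1 <= j < K.+1) j%:R `^ (1 / 56 - 1) <= 2 / (1 / 56) * K%:R `^ (1 / 56) :> R.
    by apply: sum_powR_le; lra.
  rewrite (_ : 2 / (1 / 56) = 112); last by field.
  have K1 : 1 <= K%:R `^ (1 / 56) :> R.
    by rewrite -[leLHS](powRr0 K%:R) ler_powR //; lra.
  have : \sum_(1 <= j < K.+1) (j%:R^-1 : R) <= \sum_(1 <= j < K.+1) j%:R `^ (1 / 56 - 1).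
    rewrite big_nat_cond [leRHS]big_nat_cond.
    apply: ler_sum => k /andP[/andP[k0 _] _].
    rewrite -powR_inv1 ?ler0n // ler_powR ?ler1n //; lra.
  move=> h1 h2.
  apply: le_trans (lerD K1 (le_trans h1 h2)) _; lra.
have qD : q%:R `^ (2^-1 - s) <= q%:R `^ (- (3 / 7)) :> R by rewrite ler_powR ?ler1n //; lra.
rewrite (_ : 5 / 56 = 1 / 14 + 1 / 56); last by field.
rewrite powRD_gt0 ?(lt_le_trans ltr01) //.
have -> : 3164 * (q%:R `^ (- (3 / 7)) * (K%:R `^ (1 / 14) * K%:R `^ (1 / 56))) =
  q%:R `^ (- (3 / 7)) * (28 * K%:R `^ (1 / 14)) * (113 * K%:R `^ (1 / 56)) :> R by ring.
apply: ler_pM => //.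
  by rewrite addr_ge0 // sumr_ge0 // => k _; rewrite invr_ge0.
apply: ler_pM => //.
by rewrite sumr_ge0 // => j _; apply: powR_ge0.
Qed.

End Moments.

(** * The logarithm of L *)


Section ComplexLimits.
Variables (R : realType) (T : Type) (F : set_system T).
Hypothesis FF : Filter F.
Implicit Types (f g : T -> R[i]) (a b l : R[i]).

(** The filter is arbitrary because log L is studied both at points of [s, +oo[ and at +oo. *)
Definition ccvg f l := forall e : R, 0 < e -> \forall x \near F, cabs (f x - l) < e.

Lemma ccvg_cst l : ccvg (fun=> l) l.
Proof. by move=> e e0; apply: nearW => x; rewrite subrr cabs0. Qed.

Lemma ccvgD f g a b : ccvg f a -> ccvg g b -> ccvg (fun x => f x + g x) (a + b).
Proof.
move=> fa gb e e0; have e2 : 0 < e / 2 by rewrite divr_gt0.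
apply: filterS2 (fa _ e2) (gb _ e2) => x xa xb.
rewrite (_ : _ - _ = (f x - a) + (g x - b)); last by ring.
by apply: le_lt_trans (cabsD _ _) _; lra.
Qed.

Lemma ccvgM f g a b : ccvg f a -> ccvg g b -> ccvg (fun x => f x * g x) (a * b).
Proof.
move=> fa gb e e0; have [a0 b0] := (cabs_ge0 a, cabs_ge0 b).
set M := 1 + cabs a + cabs b; have M0 : 0 < M by rewrite /M; lra.
pose d := Num.min 1 (e / M).
have d0 : 0 < d by rewrite lt_min ltr01 divr_gt0.
have d1 : d <= 1 by rewrite ge_min lexx.
have dM : d * M <= e by rewrite -ler_pdivlMr // ge_min lexx orbT.
apply: filterS2 (fa _ d0) (gb _ d0) => x xa xb.
rewrite (_ : _ - _ = (f x - a) * (g x - b) + (a * (g x - b) + b * (f x - a))); last by ring.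
apply: le_lt_trans (cabsD _ _) _; rewrite cabsM.
apply: le_lt_trans (lerD (lexx _) (cabsD _ _)) _; rewrite !cabsM.
have [u0 v0] := (cabs_ge0 (f x - a), cabs_ge0 (g x - b)).
move: xa xb u0 v0 dM; rewrite /M; set u := cabs (f x - a); set v := cabs (g x - b).
move=> xa xb u0 v0 dM.
have : u * v <= u by rewrite ler_piMr //; lra.
have : cabs a * v <= cabs a * d by rewrite ler_wpM2l // ltW.
have : cabs b * u <= cabs b * d by rewrite ler_wpM2l // ltW.
lra.
Qed.

Lemma ccvgN f a : ccvg f a -> ccvg (fun x => - f x) (- a).
Proof.
move=> fa e /fa; apply: filterS => x.
by rewrite -opprD cabsN.
Qed.

Lemma ccvg_sum (I : eqType) (r : seq I) (f : I -> T -> R[i]) (a : I -> R[i]) :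
  (forall i, i \in r -> ccvg (f i) (a i)) ->
  ccvg (fun x => \sum_(i <- r) f i x) (\sum_(i <- r) a i).
Proof.
elim: r => [|i r IH] fa.
  by rewrite big_nil => e /(ccvg_cst 0); apply: filterS => x; rewrite big_nil.
have fi := fa i (mem_head _ _).
have {}IH := IH (fun j jr => fa j (mem_behead (s := i :: r) jr)).
rewrite big_cons => e /(ccvgD fi IH); apply: filterS => x.
by rewrite big_cons.
Qed.

Lemma ccvg_prod (I : eqType) (r : seq I) (f : I -> T -> R[i]) (a : I -> R[i]) :
  (forall i, i \in r -> ccvg (f i) (a i)) ->
  ccvg (fun x => \prod_(i <- r) f i x) (\prod_(i <- r) a i).
Proof.
elim: r => [|i r IH] fa.
  by rewrite big_nil => e /(ccvg_cst 1); apply: filterS => x; rewrite big_nil.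
have fi := fa i (mem_head _ _).
have {}IH := IH (fun j jr => fa j (mem_behead (s := i :: r) jr)).
rewrite big_cons => e /(ccvgM fi IH); apply: filterS => x.
by rewrite big_cons.
Qed.

Lemma ccvg_real (r : T -> R) (l : R) : r @ F --> l -> ccvg (fun x => (r x)%:C) l%:C.
Proof.
move=> /cvgrPdistC_lt rl e /rl; apply: filterS => x.
by rewrite -rmorphB cabsR.
Qed.

Lemma ccvg_clog f a (r : R) : r < 1 -> cabs a <= r ->
  (\forall x \near F, cabs (f x) <= r) -> ccvg f a ->
  ccvg (fun x => clog (f x)) (clog a).
Proof.
move=> r1 ar fr fa e e0; have e1 : 0 < e * (1 - r) by rewrite mulr_gt0 // subr_gt0.
apply: filterS2 fr (fa _ e1) => x xr xa.
by apply: le_lt_trans (clog_lipschitz xr ar r1) _; rewrite ltr_pdivrMr ?subr_gt0.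
Qed.

End ComplexLimits.

(** * Continuity of L and the branch of its logarithm *)

Section LogL.
Variable R : realType.
Implicit Types (chi : nat -> R[i]) (q : nat) (x s : R) (L : R -> R[i]).

Lemma clog0 : clog (0 : R[i]) = 0.
Proof.
have := @cabs_clog R 0; rewrite cabs0 mul0r mulr0 => /(_ ltr01) H.
by apply/eqP; rewrite -cabs_eq0 eq_le H cabs_ge0.
Qed.

Lemma continuous_powRN (n : nat) : (0 < n)%N ->
  continuous (fun x : R => n%:R `^ (- x)).
Proof.
move=> n0 x; have nR : n%:R != 0 :> R by rewrite pnatr_eq0 -lt0n.
have -> : (fun x : R => n%:R `^ (- x)) = fun x : R => expR (- x * ln n%:R).
  by apply/funext => y; rewrite /powR (negbTE nR).
apply: (@continuous_comp _ _ _ (fun x : R => - x * ln n%:R) expR); last exact: continuous_expR.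
by apply: cvgMl; apply: cvgN; apply: cvg_id.
Qed.

Lemma cvg_powRN_pinfty (n : nat) : (1 < n)%N ->
  n%:R `^ (- x) @[x --> +oo] --> (0 : R).
Proof.
move=> n1; have nR : 1 < n%:R :> R by rewrite ltr1n.
have l0 : 0 < ln (n%:R : R) by rewrite ln_gt0.
apply/cvgrPdist_lt => e e0.
have : \forall x \near +oo, e^-1 / ln n%:R < x by apply: nbhs_pinfty_gt; rewrite num_real.
apply: filterS => x; rewrite ltr_pdivrMr // => ex; rewrite sub0r normrN ger0_norm ?powR_ge0 // powRN -[ltRHS]invrK.
have n0 : 0 < n%:R :> R by apply: lt_trans nR.
rewrite ltf_pV2 ?posrE ?invr_gt0 ?powR_gt0 //.
rewrite /powR gt_eqF //.
apply: lt_le_trans (expR_ge1Dx _).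
by lra.
Qed.

Lemma cabs_lterm q chi x n : dirichlet_character q chi ->
  cabs (lterm chi x n) <= n%:R `^ (- x).
Proof.
move=> chiD; rewrite ltermE cabsM cabsR ger0_norm ?powR_ge0 //.
by rewrite ler_piMl ?powR_ge0 // (cabs_char _ chiD).
Qed.

(** The worst case is 2^(-1/2) <= 3/4. A fixed disc of radius below 1 makes [clog] Lipschitz with
    one constant for all primes. *)
Lemma cabs_lterm_prime q chi x p : dirichlet_character q chi -> prime p ->
  2^-1 <= x -> cabs (lterm chi x p) <= 3 / 4.
Proof.
move=> chiD pp x2; apply: le_trans (cabs_lterm x p chiD) _.
have p1 : (1 < p)%N by exact: prime_gt1.
apply: (@le_trans _ _ (p%:R `^ (- 2^-1))); first by rewrite ler_powR ?ler1n ?lerN2 // ltnW.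
apply: (@le_trans _ _ (2%:R `^ (- 2^-1))).
  by apply: powRN_homo => //; rewrite invr_ge0.
rewrite powRN invf_ple ?posrE ?powR_gt0 //.
rewrite (_ : (3 / 4)^-1 = 4 / 3 :> R); last by field.
have E : (2 `^ 2^-1) ^+ 2 = 2 :> R by rewrite powR_sqr // mulVf // powRr1.
have := powR_ge0 (2 : R) 2^-1; nra.
Qed.

Lemma ccvg_lterm (F : set_system R) (FF : Filter F) chi n (l : R) :
  n%:R `^ (- x) @[x --> F] --> l ->
  ccvg F (fun x => lterm chi x n) (chi n * l%:C).
Proof.
move=> nl; have := ccvgM FF (ccvg_cst FF (chi n)) (ccvg_real FF nl).
by under eq_fun do rewrite -ltermE.
Qed.

(** The continuous partial sums converge uniformly on [s, +oo[, the rate at x being at most the rate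
    at s. *)
Lemma lvalue_continuous q chi s L x0 : 0 < s -> s <= x0 -> lvalue_rate q chi s L ->
  ccvg (within `[s, +oo[ (nbhs x0)) L (L x0).
Proof.
move=> s0 sx0 HL e e0.
have e3 : 0 < e / 3 by rewrite divr_gt0.
have [u Hu] : exists u : nat, 2 * (q%:R * u.+1%:R `^ (- s)) < e / 3.
  have : (fun u : nat => 2 * q%:R * u.+1%:R `^ (- s)) @ \oo --> (0 : R).
    by rewrite -(mulr0 (2 * q%:R)); apply: cvgMr; apply: cvg_powRN.
  move=> /cvgrPdist_lt/(_ _ e3)[N _ /(_ N (leqnn N))].
  rewrite sub0r normrN ger0_norm ?mulr_ge0 ?powR_ge0 ?ler0n // -mulrA => H.
  by exists N.
have bound x : s <= x -> cabs (L x - lsum chi x u) < e / 3.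
  move=> sx; apply: le_lt_trans Hu; apply: le_trans (HL _ sx u) _.
  by rewrite ler_wpM2l // ler_wpM2l ?ler0n // ler_powR ?ler1n // lerN2.
have FF : Filter (within `[s, +oo[ (nbhs x0)) by exact: within_filter.
have lc : ccvg (within `[s, +oo[ (nbhs x0)) (fun x => lsum chi x u) (lsum chi x0 u).
  rewrite /lsum; apply: (@ccvg_sum _ _ _ FF _ _ (fun n x => lterm chi x n)) => n.
  rewrite mem_index_iota => /andP[n0 _]; rewrite ltermE; apply: ccvg_lterm; apply: cvg_within_filter.
  exact: continuous_powRN.
have inA : \forall x \near within `[s, +oo[ (nbhs x0), s <= x.
  by rewrite near_withinE; apply: nearW => x /=; rewrite in_itv /= andbT.
apply: filterS2 inA (lc _ e3) => x sx xu.
apply: le_lt_trans (cabs_dist _ (lsum chi x u) _) _.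
apply: le_lt_trans (lerD (lexx _) (cabs_dist _ (lsum chi x0 u) _)) _.
have := bound _ sx; have := bound _ sx0; rewrite cabsB; lra.
Qed.

(** This is the E(x) of the overview. *)
Definition euler_error chi (ps : seq nat) L x : R[i] :=
  (\prod_(p <- ps) (1 - lterm chi x p)) * L x - 1.

Lemma log_L_euler q chi s L (ps : seq nat) : nonprincipal q chi -> 2^-1 <= s ->
  lvalue_rate q chi s L -> all prime ps ->
  (forall x, s <= x -> cabs (euler_error chi ps L x) <= 2^-1) ->
  log_L q chi s (- clog (- euler_error chi ps L s) + \sum_(p <- ps) clog (lterm chi s p)).
Proof.
move=> np s2 HL psP HE; have chiD := np.1.
have s0 : 0 < s by apply: lt_le_trans s2; rewrite invr_gt0.
have half1 : 2^-1 < 1 :> R by lra.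
have q34 : 3 / 4 < 1 :> R by lra.
have lt34 x p : s <= x -> p \in ps -> cabs (lterm chi x p) <= 3 / 4.
  by move=> sx pps; apply: (cabs_lterm_prime chiD (allP psP _ pps)); apply: le_trans sx.
pose g x : R[i]^o := - clog (- euler_error chi ps L x) + \sum_(p <- ps) clog (lterm chi x p).
(* Continuity at x0 and the limit at +oo are treated together: t p is the limit of p^(-x), namely
   p^(-x0) or 0. *)
have gF (F : set_system R) (FF : Filter F) (t : nat -> R) (lL : R[i]) :
    (\forall x \near F, s <= x) ->
    (forall p, p \in ps -> p%:R `^ (- x) @[x --> F] --> t p) -> ccvg F L lL ->
    cabs ((\prod_(p <- ps) (1 - chi p * (t p)%:C)) * lL - 1) <= 2^-1 ->
    (forall p, p \in ps -> cabs (chi p * (t p)%:C) <= 3 / 4) ->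
    ccvg F g (- clog (- ((\prod_(p <- ps) (1 - chi p * (t p)%:C)) * lL - 1)) +
      \sum_(p <- ps) clog (chi p * (t p)%:C)).
  move=> sF tF LF Eb tb.
  have lF p : p \in ps -> ccvg F (fun x => lterm chi x p) (chi p * (t p)%:C).
    by move=> pps; apply: ccvg_lterm; apply: tF.
  have PF : ccvg F (fun x => \prod_(p <- ps) (1 - lterm chi x p))
      (\prod_(p <- ps) (1 - chi p * (t p)%:C)).
    apply: ccvg_prod => p pps.
    exact: (ccvgD FF (ccvg_cst FF 1) (ccvgN FF (lF _ pps))).
  have EF := ccvgD FF (ccvgM FF PF LF) (ccvg_cst FF (-1)).
  apply: ccvgD.
    apply: ccvgN; apply: (@ccvg_clog _ _ _ FF _ _ 2^-1) => //.
    - by rewrite cabsN.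
    - by apply: filterS sF => x sx; rewrite cabsN HE.
    - exact: ccvgN.
  apply: (@ccvg_sum _ _ _ FF _ _ (fun p x => clog (lterm chi x p))) => p pps.
  apply: (@ccvg_clog _ _ _ FF _ _ (3 / 4)) => //; [exact: tb| |exact: lF].
  by apply: filterS sF => x sx; apply: lt34.
have p0 p : p \in ps -> (1 < p)%N by move=> /(allP psP)/prime_gt1.
exists g; split=> //.
- apply/subspace_continuousP => x0 /=; rewrite in_itv /= andbT => sx0.
  apply/cvg_cabs.
  have FF : Filter (within `[s, +oo[ (nbhs x0)) by exact: within_filter.
  have := gF _ FF (fun p => p%:R `^ (- x0)) (L x0).
  have -> : \prod_(p <- ps) (1 - chi p * (p%:R `^ (- x0))%:C) = \prod_(p <- ps) (1 - lterm chi x0 p).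
    by apply: eq_bigr => p _; rewrite ltermE.
  have -> : \sum_(p <- ps) clog (chi p * (p%:R `^ (- x0))%:C) = \sum_(p <- ps) clog (lterm chi x0 p).
    by apply: eq_bigr => p _; rewrite ltermE.
  apply.
  + by rewrite near_withinE; apply: nearW => x /=; rewrite in_itv /= andbT.
  + by move=> p /p0 p1; apply: cvg_within_filter; apply: continuous_powRN; apply: ltnW.
  + exact: (lvalue_continuous s0 sx0 HL).
  + exact: HE.
  + by move=> p pps; rewrite -ltermE; apply: lt34.
- move=> x sx; have x0 : 0 < x by apply: lt_le_trans sx.
  suff -> : cexp (g x) = L x by apply: (dirichlet_L_lvalue np HL).
  rewrite /g cexpD cexpN cexp_sum.
  have := @cexp_clog_mul R (- euler_error chi ps L x); rewrite cabsN.
  rewrite (le_lt_trans (HE _ sx)) // => /(_ isT) E1.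
  have lne p : p \in ps -> cexp (clog (lterm chi x p)) * (1 - lterm chi x p) = 1.
    by move=> pps; apply: cexp_clog_mul; apply: le_lt_trans (lt34 _ _ sx pps) _.
  have E2 : (\prod_(p <- ps) cexp (clog (lterm chi x p))) * \prod_(p <- ps) (1 - lterm chi x p) = 1.
    by rewrite -big_split /= big1_seq // => p /andP[_ pps]; rewrite lne.
  have -> : (cexp (clog (- euler_error chi ps L x)))^-1 = 1 + euler_error chi ps L x.
    apply: (mulfI (x := cexp (clog (- euler_error chi ps L x)))).
      by apply/eqP => c0; move: E1; rewrite c0 mul0r => /eqP; rewrite eq_sym oner_eq0.
    rewrite mulfV; first by rewrite -[LHS]E1 opprK.
    by apply/eqP => c0; move: E1; rewrite c0 mul0r => /eqP; rewrite eq_sym oner_eq0.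
  by rewrite /euler_error addrC subrK mulrC mulrA E2 mul1r.
- apply/cvg_cabs.
  have FF : Filter (pinfty_nbhs R) by exact: proper_pinfty_nbhs.
  have sF : \forall x \near +oo, s <= x by apply: nbhs_pinfty_ge; rewrite num_real.
  have L1 : ccvg (pinfty_nbhs R) L 1.
    move=> e e0; have e1 : 0 < e / (2 * q%:R + 1).
      by rewrite divr_gt0 // ltr_wpDl // mulr_ge0.
    have /cvgrPdist_lt/(_ _ e1) := @cvg_powRN_pinfty 2 isT.
    apply: filterS2 sF => x sx; rewrite sub0r normrN ger0_norm ?powR_ge0 // => x2.
    (* The rate at u = 1, where the partial sum is chi(1) = 1, gives |L x - 1| <= 2q 2^(-x). *)
    have := HL _ sx 1%N; rewrite {1}/lsum big_nat1 ltermE powR1 mulr1.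
    have [_ -> _ _ _] := chiD => /le_lt_trans; apply.
    move: x2; rewrite ltr_pdivlMr; last by rewrite ltr_wpDl // mulr_ge0.
    have := powR_ge0 (2 : R) (- x); lra.
  have := gF _ FF (fun p => 0) 1 sF (fun p pps => cvg_powRN_pinfty (p0 p pps)) L1.
  have -> : \prod_(p <- ps) (1 - chi p * 0%:C) = 1.
    by apply: big1 => p _; rewrite mulr0 subr0.
  have -> : \sum_(p <- ps) clog (chi p * 0%:C) = 0.
    by apply: big1 => p _; rewrite mulr0 clog0.
  move=> H; rewrite mul1r subrr oppr0 clog0 oppr0 add0r cabs0 in H.
  apply: H.
    by rewrite invr_ge0.
  by move=> p _; rewrite mulr0 cabs0; lra.
Qed.

End LogL.

(** * Comparison with the Euler product *)


Section EulerProduct.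
Variable R : realType.
Implicit Types (chi : nat -> R[i]) (q : nat) (x s : R) (L : R -> R[i]).

(** By multiplicativity the inner series is the logarithm series at chi(p)/p^s without its linear
    term. *)
Lemma prime_power_inner q chi s p : dirichlet_character q chi -> prime p ->
  2^-1 <= s ->
  \big[+%R/0]_(2 <= l <oo)
    (chi (p ^ l)%N / (l%:R * p%:R `^ (l%:R * s))%:C : R[i]^o) =
  clog (lterm chi s p) - lterm chi s p.
Proof.
move=> chiD pp s2; set z := lterm chi s p.
have z34 : cabs z <= 3 / 4 by apply: (cabs_lterm_prime chiD pp s2).
have z1 : 3 / 4 < 1 :> R by lra.
have termE l : chi (p ^ l)%N / (l%:R * p%:R `^ (l%:R * s))%:C = z ^+ l / l%:R.
  have -> : chi (p ^ l)%N = chi p ^+ l.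
    case: chiD => _ c1 cM _ _.
    by elim: l => [|l IH]; rewrite ?expn0 ?c1 // expnS cM IH exprS.
  rewrite /z /lterm mulrC (mulrC _ s) powRrM powR_mulrn ?powR_ge0 // exprMn.
  by rewrite rmorphM rmorphXn rmorph_nat /= invfM exprVn; ring.
apply: (@cvg_lim (R[i]^o)); first exact: norm_hausdorff.
rewrite -(cvg_shiftn 2) /=.
apply: (@cvg_rate _ _ (fun n => (2 * (3 / 4) ^+ 2 / (1 - 3 / 4)) * (3 / 4) ^+ n)).
  move=> n.
  have -> : \sum_(2 <= l < n + 2) chi (p ^ l)%N / (l%:R * p%:R `^ (l%:R * s))%:C =
      logpart (n + 2) z - z.
    rewrite /logpart addn2 [X in _ = X - _]big_ltn // expr1 divr1 addrAC subrr add0r.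
    by apply: eq_bigr => l _; rewrite termE.
  rewrite opprB addrA subrK.
  apply: le_trans (clog_cvg_rate _ z34 z1) _; first by rewrite addn2.
  by rewrite exprD le_eqVlt; apply/orP; left; apply/eqP; ring.
by apply: cvg_geometric_rate; lra.
Qed.

(** Each prime contributes at most 8 p^(-2s), as 1 - |z| >= 1/4; summing over p > Y gives 16, as 2s
    - 1 >= 1/2, and [complex_rate_limit] doubles it. *)
Lemma prime_power_sum_tail q chi s (Y : nat) : dirichlet_character q chi ->
  3 / 4 <= s -> (0 < Y)%N ->
  cabs (prime_power_sum chi s -
    \sum_(0 <= p < Y.+1 | prime p) (clog (lterm chi s p) - lterm chi s p)) <=
  32 * Y%:R `^ (1 - s * 2).
Proof.
move=> chiD s34 Y0.
have s2 : 2^-1 <= s by lra.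
pose h p := clog (lterm chi s p) - lterm chi s p.
have hb p : prime p -> cabs (h p) <= 8 * p%:R `^ (- (s * 2)).
  move=> pp; have z34 := cabs_lterm_prime chiD pp s2.
  apply: le_trans (cabs_clogB _) _; first by apply: le_lt_trans z34 _; lra.
  have zp := cabs_lterm s p chiD.
  rewrite -mulNr -powR_sqr ?ltr0n ?prime_gt0 //.
  apply: (@le_trans _ _ (2 * (cabs (lterm chi s p) ^+ 2 / 4^-1))).
    rewrite ler_wpM2l // ler_wpM2l ?sqr_ge0 // lef_pV2 ?posrE; lra.
  have zz : cabs (lterm chi s p) ^+ 2 <= (p%:R `^ (- s)) ^+ 2.
    by rewrite lerXn2r ?nnegrE ?cabs_ge0 ?powR_ge0.
  by rewrite invrK; lra.
have tail n m : (0 < n)%N -> (n <= m)%N ->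
    cabs (\sum_(0 <= p < m.+1 | prime p) h p - \sum_(0 <= p < n.+1 | prime p) h p) <=
    16 * n%:R `^ (1 - s * 2).
  move=> n0 nm; rewrite (@big_cat_nat _ _ _ n.+1) //= addrAC subrr add0r.
  apply: le_trans (cabs_sum _ _ _) _.
  apply: (@le_trans _ _ (\sum_(n.+1 <= p < m.+1) 8 * p%:R `^ (- (s * 2)))).
    rewrite big_mkcond; apply: ler_sum => p _; case: ifP => [/hb //|_].
    by rewrite mulr_ge0 ?powR_ge0.
  rewrite -mulr_sumr; apply: (@le_trans _ _ (8 * (n%:R `^ (1 - s * 2) / (s * 2 - 1)))).
    by rewrite ler_wpM2l //; apply: sum_powR_tail => //; lra.
  rewrite (_ : 16 = 8 * 2); last by ring.
  rewrite -[leRHS]mulrA ler_wpM2l // mulrC ler_wpM2r ?powR_ge0 //.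
  by rewrite invf_ple ?posrE; lra.
have [l Hl] : exists l, forall n, cabs (l - \sum_(0 <= p < n.+2 | prime p) h p) <=
    2 * (16 * n.+1%:R `^ (1 - s * 2)).
  apply: (@complex_rate_limit _ (fun n => \sum_(0 <= p < n.+2 | prime p) h p)).
  by move=> n m nm; apply: tail.
have -> : prime_power_sum chi s = l.
  rewrite /prime_power_sum; apply: (@cvg_lim (R[i]^o)); first exact: norm_hausdorff.
  rewrite -(cvg_shiftn 2) /=.
  apply: (@cvg_rate _ _ (fun n => 32 * n.+1%:R `^ (- (s * 2 - 1)))).
    move=> n; rewrite (eq_bigr h); last by move=> p pp; apply: (prime_power_inner chiD).
    by rewrite opprB addn2 (_ : 32 = 2 * 16) -?mulrA //; ring.
  by rewrite -(mulr0 32); apply: cvgMr; apply: cvg_powRN; lra.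
case: Y Y0 => // Y _; have := Hl Y; rewrite mulrA.
by rewrite (_ : 2 * 16 = 32) //; ring.
Qed.

Definition primes_upto (Y : nat) : seq nat := [seq p <- index_iota 0 Y.+1 | prime p].

Lemma all_primes_upto Y : all prime (primes_upto Y).
Proof. by rewrite /primes_upto; exact: filter_all. Qed.

Lemma uniq_primes_upto Y : uniq (primes_upto Y).
Proof. by rewrite filter_uniq // iota_uniq. Qed.

Lemma mem_primes_upto Y p : (p \in primes_upto Y) = prime p && (p <= Y)%N.
Proof. by rewrite mem_filter mem_index_iota. Qed.

Lemma rough_gt Y k : (1 < k)%N -> (k <= Y)%N -> ~~ coprime_to (primes_upto Y) k.
Proof.
move=> k1 kY; apply/allPn; exists (pdiv k); last by rewrite negbK pdiv_dvd.
by rewrite mem_primes_upto pdiv_prime // (leq_trans (pdiv_leq (ltnW k1))).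
Qed.

Lemma rsum_split q chi x (Y K : nat) : dirichlet_character q chi ->
  (0 < Y)%N -> (Y <= K)%N ->
  rsum chi (primes_upto Y) x K =
    1 + \sum_(Y.+1 <= k < K.+1 | coprime_to (primes_upto Y) k) lterm chi x k.
Proof.
move=> chiD Y0 YK; rewrite /rsum (@big_cat_nat _ _ _ Y.+1) //=; congr (_ + _).
rewrite big_mkcond big_ltn //= big_nat_cond big1 => [|k /andP[/andP[k1 kY] _]].
  have -> : coprime_to (primes_upto Y) 1.
    apply/allP => p; rewrite mem_primes_upto => /andP[pp _].
    by rewrite dvdn1 neq_ltn (prime_gt1 pp) orbT.
  by rewrite addr0 /lterm powR1 divr1; case: chiD.
by rewrite (negbTE (rough_gt k1 _)).
Qed.

(** Summation by parts with the weights k^(s - x). The condition 2 < Y ensures k >= 4 in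
    [powR_diff_le]. *)
Lemma rough_sum_bound chi s x (ps : seq nat) (Y K : nat) : s <= x ->
  (2 < Y)%N -> (Y <= K)%N ->
  cabs (\sum_(Y.+1 <= k < K.+1 | coprime_to ps k) lterm chi x k) <=
    rough_majorant chi ps s Y K.+1.
Proof.
move=> sx Y3 YK.
pose c k := if coprime_to ps k then lterm chi s k else 0.
have cE n : \sum_(n <= k < K.+1) c k = rough_tail chi ps s n K.+1.
  by rewrite /rough_tail [RHS]big_mkcond.
have -> : \sum_(Y.+1 <= k < K.+1 | coprime_to ps k) lterm chi x k =
    \sum_(Y.+1 <= k < K.+1) c k * (k%:R `^ (- (x - s)))%:C.
  rewrite big_mkcond big_nat_cond [RHS]big_nat_cond; apply: eq_bigr => k /andP[/andP[Yk _] _].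
  have k0 : 0 < k%:R :> R by rewrite ltr0n (leq_trans _ Yk).
  rewrite /c; case: ifP => _; last by rewrite mul0r.
  rewrite !ltermE -mulrA -rmorphM -powRD_gt0 //.
  by congr (_ * (_ `^ _)%:C); ring.
have xs0 : 0 <= x - s by lra.
apply: le_trans (abel_tail_bound _ _ _) _ => //.
rewrite /rough_majorant cE; apply: lerD.
  rewrite ger0_norm ?powR_ge0 // ler_piMr ?cabs_ge0 //.
  rewrite powRN invf_le1 ?powR_gt0 ?ltr0n //.
  by rewrite -[leLHS](powRr0 Y.+1%:R) ler_powR // ler1n.
rewrite big_nat_cond [leRHS]big_nat_cond; apply: ler_sum => k /andP[/andP[Yk _] _].
rewrite cE ler_wpM2l ?cabs_ge0 //; apply: powR_diff_le => //.
by apply: leq_trans Yk.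
Qed.

Lemma euler_error_le q chi s L x (b th : R) (Y K : nat) :
  dirichlet_character q chi -> lvalue_rate q chi s L -> s <= x ->
  (2 < Y)%N -> (Y <= K)%N ->
  0 < b <= 1 -> 0 <= th -> 1 - s + th = b -> th <= s -> 1 - s <= b ->
  cabs (euler_error chi (primes_upto Y) L x) <=
    rough_majorant chi (primes_upto Y) s Y K.+1 +
    (2 + 2 / b) * q%:R `^ (th + b) * expR (2 / b * Y%:R `^ b) * K.+1%:R `^ (- th).
Proof.
move=> chiD HL sx Y3 YK b01 th0 sb ths s1b; have [b0 b1] := andP b01.
have Y0 : (0 < Y)%N by apply: leq_trans Y3.
have H1 := rough_error K chiD th0 (fun u => lvalue_tail_le u chiD HL sx b01 th0 sb ths s1b)
  (uniq_primes_upto Y) (all_primes_upto Y).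
rewrite (rsum_split x chiD Y0 YK) in H1.
set S := \sum_(Y.+1 <= k < _ | _) _ in H1.
rewrite /euler_error; set P := _ * L x in H1 *.
have -> : P - 1 = S + (P - (1 + S)) by ring.
apply: le_trans (cabsD _ _) _; apply: lerD; first exact: rough_sum_bound.
apply: le_trans H1 _; rewrite ler_wpM2r ?powR_ge0 // ler_wpM2l //.
  by rewrite mulr_ge0 ?powR_ge0 // addr_ge0 // divr_ge0 // ltW.
(* As x - th >= 1 - b, the sum over primes is at most the sum of k^(b-1) over all k <= Y. *)
rewrite ler_expR; apply: le_trans _ (sum_powR_le Y b01).
rewrite /primes_upto big_filter big_ltn_cond //=.
rewrite big_mkcond big_nat_cond [leRHS]big_nat_cond; apply: ler_sum => k /andP[/andP[k0 _] _].
case: ifP => _; last exact: powR_ge0.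
by rewrite ler_powR ?ler1n //; lra.
Qed.

(** Separating the linear terms of the Euler logarithms leaves the prime powers, up to the tail over
    p > Y. The other error is |clog(-E)| <= 2 |E| / (1 - |E|) <= 4 eta. *)
Lemma log_L_approx_euler q chi s L (y eta : R) : nonprincipal q chi ->
  3 / 4 <= s -> 1 <= y -> lvalue_rate q chi s L -> eta <= 2^-1 ->
  (forall x, s <= x -> cabs (euler_error chi (primes_upto (Num.truncn y)) L x) <= eta) ->
  log_L_approx q chi s y (4 * eta + 32 * (Num.truncn y)%:R `^ (1 - s * 2)).
Proof.
move=> np s34 y1 HL eta2 HE; have chiD := np.1.
set Y := Num.truncn y in HE *.
have Y0 : (0 < Y)%N by rewrite /Y truncn_gt0.
have s2 : 2^-1 <= s by lra.
exists (- clog (- euler_error chi (primes_upto Y) L s) +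
        \sum_(p <- primes_upto Y) clog (lterm chi s p)); split.
  apply: log_L_euler => //; first exact: all_primes_upto.
  by move=> x sx; apply: le_trans (HE x sx) _.
rewrite cabs_le; have T := prime_power_sum_tail chiD s34 Y0.
rewrite /prime_sum -/Y; rewrite sumrB in T.
rewrite /primes_upto big_filter -/(primes_upto Y).
set A := \sum_(0 <= p < Y.+1 | prime p) clog _ in T *.
set B := \sum_(0 <= p < Y.+1 | prime p) _ in T *.
rewrite (_ : _ - _ = - clog (- euler_error chi (primes_upto Y) L s) -
   (prime_power_sum chi s - (A - B))); last by rewrite /B /lterm; ring.
apply: le_trans (cabsBD _ _) _; apply: lerD => //.
rewrite cabsN; set E := euler_error _ _ _ _.
have E1 := HE s (lexx s); rewrite -/E in E1.
apply: le_trans (cabs_clog _) _; rewrite cabsN; first by apply: le_lt_trans E1 _; lra.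
have E0 := cabs_ge0 E.
rewrite (_ : 4 = 2 * 2); last by ring.
rewrite -mulrA ler_wpM2l // ler_pdivrMr; last by lra.
nra.
Qed.

End EulerProduct.

(** * Estimates for a single Q *)


(* With sg + th = d / 16 one has A (sg + th) < 7 / 8, so that the Euler factors cost
   only exp(O((log Q)^(7/8))).  The truncation at K, of size Q^4, gains
   Q^(b - 3 th) <= Q^(- d / 56), while K^sg <= Q^(2/7) stays harmless in the first
   moments. *)
Section SinglePoint.
Variables (R : realType) (d Q a A f eta c : R).
Let l := ln Q.
Let V := l `^ (A / 2).
Let y := l `^ A.
Let Y := Num.truncn y.
Let sg := a / l.
Let s := 1 - sg.
Let b := d / 16.
Let th := b - sg.
Let N0 := (Num.truncn Q).+1.
Let K := (N0 ^ 4)%N.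
(** [a], [A] and [f] are values at one Q. [fa] and [fV] are the two little-o conditions, with
    constants eta and 1/4. [grow1] serves the truncation at K, and [grow2] the terms of the moments
    other than the diagonal ones; the 16 in [c16] comes from K <= 16 Q^4. *)
Hypotheses (d02 : 0 < d < 2) (l1 : 1 <= l) (Q1 : 1 <= Q)
  (ad : 0 <= 28 * a < d * l) (aA : 28 * a / (d * l) < A < 14 / d)
  (V2 : 2 <= V) (f1 : 1 <= f) (fV : 4 * f <= V)
  (fa : l `^ (14 * a / (d * l)) <= eta * f)
  (grow1 : (2 + 2 / b) * l `^ (7 / d) * expR (2 / b * l `^ (7 / 8)) <= expR (d / 56 * l))
  (c16 : 3164 * 16 <= c) (grow2 : c * l `^ (7 / d) <= eta * expR (l / 14)).

Let d0 : 0 < d.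
Proof. by case/andP: d02. Qed.
Let l0 : 0 < l.
Proof. exact: lt_le_trans l1. Qed.
Let Q0 : 0 < Q.
Proof. exact: lt_le_trans Q1. Qed.
Let b0 : 0 < b.
Proof. by rewrite divr_gt0. Qed.
Let f0 : 0 < f.
Proof. exact: lt_le_trans f1. Qed.
Let V0 : 0 < V.
Proof. exact: powR_gt0. Qed.
Let QE : Q = expR l.
Proof. by rewrite /l lnK. Qed.

Let sg_ge0 : 0 <= sg.
Proof. by rewrite divr_ge0 ?(ltW l0) //; case/andP: ad; lra. Qed.

Let sg_lt : sg < d / 28.
Proof. by rewrite /sg ltr_pdivrMr //; case/andP: ad; lra. Qed.

Let A_lt : A < 14 / d.
Proof. by case/andP: aA. Qed.

Let yE : y = V * V.
Proof. by rewrite -powRD_gt0 //; congr (_ `^ _); field. Qed.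

Let y4 : 4 <= y.
Proof. by rewrite yE (_ : 4 = 2 * 2); [apply: ler_pM|ring]. Qed.

Let Y4 : (3 < Y)%N.
Proof. by rewrite /Y truncn_gt_nat; exact: y4. Qed.

Let Y0 : 0 < Y%:R :> R.
Proof. by rewrite ltr0n (leq_trans _ Y4). Qed.

Let Y_le : Y%:R <= y.
Proof. by rewrite /Y truncn_le; apply: le_trans y4. Qed.

Let Y_ge : y / 2 <= Y%:R.
Proof.
have := truncnS_gt y; rewrite -/Y -natr1.
have : (1 : R) <= Y%:R by rewrite ler1n (leq_trans _ Y4).
lra.
Qed.

Let powRY (e : R) : 0 <= e <= 1 -> Y%:R `^ (- e) <= 2 * y `^ (- e).
Proof.
move=> /andP[e0 e1]; have y20 : 0 < y / 2 by rewrite divr_gt0 //; apply: lt_le_trans y4.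
apply: (@le_trans _ _ ((y / 2) `^ (- e))).
  by rewrite !powRN lef_pV2 ?posrE ?powR_gt0 // ge0_ler_powR ?nnegrE ?ler0n // ltW.
rewrite powRM ?invr_ge0 //; last by apply: le_trans y4.
rewrite mulrC ler_wpM2r ?powR_ge0 //.
rewrite -powR_inv1 // -powRrM mulN1r opprK -[leRHS](powRr1 (a := 2)) //.
by rewrite ler_powR // ler1n.
Qed.

Let N0_gt : Q < N0%:R.
Proof. exact: truncnS_gt. Qed.

Let N0_le : N0%:R <= 2 * Q.
Proof.
have : (Num.truncn Q)%:R <= Q by rewrite truncn_le ltW.
by rewrite /N0 -natr1; have := Q1; lra.
Qed.

Let YK : (Y <= K)%N.
Proof.
rewrite -(ler_nat R); apply: le_trans Y_le _.
have yl : y <= l `^ (14 / d) by rewrite ler_powR // ltW.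
have l2 : (l `^ (7 / d)) ^+ 2 = l `^ (14 / d).
  by rewrite powR_sqr //; congr (_ `^ _); field; rewrite gt_eqF.
(* Read off from [grow1], whose other left factors are at least 1 and whose right side is at most
   Q. *)
have g1 : l `^ (7 / d) <= Q.
  have c1 : 2 <= 2 + 2 / b by rewrite lerDl divr_ge0 // ltW.
  have e1 : 1 <= expR (2 / b * l `^ (7 / 8)).
    by rewrite -expR0 ler_expR mulr_ge0 ?powR_ge0 // divr_ge0 // ltW.
  have p0 := powR_gt0 (7 / d) l0.
  have : expR (d / 56 * l) <= Q.
    by rewrite QE ler_expR ler_piMl ?(ltW l0) //; case/andP: d02; lra.
  apply: le_trans; apply: le_trans grow1.
  rewrite -{1}[l `^ _]mul1r -[leLHS]mulr1; apply: ler_pM => //; first by rewrite mul1r ltW.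
  by rewrite ler_wpM2r ?(ltW p0) //; lra.
have p0 := powR_ge0 l (7 / d).
apply: le_trans yl _; rewrite -l2.
have Q2 : l `^ (7 / d) ^+ 2 <= Q ^+ 2 by rewrite lerXn2r ?nnegrE // ltW.
apply: le_trans Q2 _; rewrite /K natrX.
apply: (@le_trans _ _ (Q ^+ 4)); last by rewrite lerXn2r ?nnegrE ?ler0n ?ltW.
by rewrite ler_weXn2l.
Qed.

Let K_gt : Q ^+ 4 <= K.+1%:R.
Proof.
rewrite -natr1 /K natrX; apply: (@le_trans _ _ (N0%:R ^+ 4)); last by rewrite lerDl.
by rewrite lerXn2r ?nnegrE ?ler0n ?ltW.
Qed.

(** The target error f/V is at least a fixed negative power of log Q, so any saving by a power of Q
    is more than enough. *)
Let lam_ge : l `^ (- (7 / d)) <= f / V.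
Proof.
rewrite powRN; apply: (@le_trans _ _ (V^-1)); last by rewrite ler_peMl ?invr_ge0 ?(ltW V0).
rewrite lef_pV2 ?posrE ?powR_gt0 // ler_powR //.
by move: A_lt; rewrite ltr_pdivlMr // => H; rewrite ler_pdivlMr //; lra.
Qed.

Let truncation_error (q : nat) : (0 < q)%N -> q%:R <= Q ->
  (2 + 2 / b) * q%:R `^ (th + b) * expR (2 / b * Y%:R `^ b) * K.+1%:R `^ (- th) <= f / V.
Proof.
move=> q0 qQ; have thb : 0 <= th by rewrite /th /b; move: sg_lt d0; lra.
have c0 : 0 < 2 + 2 / b by rewrite addr_gt0 // divr_gt0.
have cb : 0 <= 2 / b by rewrite divr_ge0 // ltW.
apply: le_trans lam_ge.
apply: (@le_trans _ _ ((2 + 2 / b) * Q `^ (th + b) * expR (2 / b * l `^ (7 / 8)) * (Q ^+ 4) `^ (- th))).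
  apply: ler_pM; rewrite ?powR_ge0 ?mulr_ge0 ?powR_ge0 ?expR_ge0 ?(ltW c0) //.
    apply: ler_pM; rewrite ?powR_ge0 ?mulr_ge0 ?powR_ge0 ?expR_ge0 ?(ltW c0) //.
      rewrite ler_wpM2l ?(ltW c0) // ge0_ler_powR ?nnegrE ?ler0n ?(ltW Q0) //.
      by rewrite addr_ge0 // ltW.
    rewrite ler_expR ler_wpM2l //; apply: (@le_trans _ _ (y `^ b)).
      by rewrite ge0_ler_powR ?nnegrE ?ler0n ?(ltW b0) ?(powR_ge0 l A).
    rewrite /y -powRrM ler_powR //.
    by move: A_lt; rewrite /b ltr_pdivlMr // => H; lra.
  rewrite !powRN lef_pV2 ?posrE ?powR_gt0 ?exprn_gt0 ?ltr0n //.
  by rewrite ge0_ler_powR ?nnegrE ?exprn_ge0 ?(ltW Q0) ?ler0n.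
rewrite -[in X in _ * X](powR_mulrn _ (ltW Q0)) -powRrM.
rewrite [leLHS](_ : _ = (2 + 2 / b) * expR (2 / b * l `^ (7 / 8)) * Q `^ (th + b + 4%:R * - th)); last first.
  by rewrite (powRD_gt0 (th + b)) //; ring.
have -> : Q `^ (th + b + 4%:R * - th) = expR ((th + b + 4%:R * - th) * l).
  by rewrite /powR gt_eqF.
(* The exponent is b - 3 th = 3 sg - 2 b < 3d/28 - d/8 = -d/56. *)
have E2 : expR ((th + b + 4%:R * - th) * l) <= expR (- (d / 56 * l)).
  rewrite ler_expR -mulNr ler_wpM2r ?(ltW l0) // /th /b; move: sg_lt; lra.
apply: le_trans (ler_wpM2l _ E2) _; first by rewrite mulr_ge0 ?expR_ge0 ?(ltW c0).
rewrite expRN ler_pdivrMr ?expR_gt0 // powRN ler_pdivlMl ?powR_gt0 //.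
by apply: le_trans _ grow1; rewrite le_eqVlt; apply/orP; left; apply/eqP; ring.
Qed.

Let powR_Y_sq : Y%:R `^ (1 - s * 2) <= 2 * (f / V).
Proof.
have Y1 : 1 <= Y%:R :> R by rewrite ler1n (leq_trans _ Y4).
apply: (@le_trans _ _ (Y%:R `^ (- 2^-1))).
  by rewrite ler_powR // /s; move: sg_lt; case/andP: d02; lra.
apply: le_trans (powRY _) _; first by lra.
rewrite ler_wpM2l // powRN /y -powRrM -/V.
by rewrite ler_peMl ?invr_ge0 ?(ltW V0).
Qed.

(** The majorant and the truncation each contribute f/V, so |E| <= 2 f/V <= 1/2, and 72 = 4 * 2 + 32
    * 2 with [powR_Y_sq] for the prime powers. *)
Lemma log_L_approx_good q (chi : nat -> R[i]) : nonprincipal q chi -> q%:R <= Q ->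
  rough_majorant chi (primes_upto Y) s Y K.+1 <= f / V ->
  log_L_approx q chi s y (72 * (f / V)).
Proof.
move=> np qQ maj; have chiD := np.1.
have q0 : (0 < q)%N by case: chiD.
have s0 : 0 <= s by rewrite /s; move: sg_lt; case/andP: d02; lra.
have [L HL] := lvalue_exists np s0.
have lam4 : f / V <= 4^-1 by rewrite ler_pdivrMr // mulrC ler_pdivlMr // mulrC.
have := @log_L_approx_euler R q chi s L y (2 * (f / V)) np.
have -> : 3 / 4 <= s by rewrite /s; move: sg_lt; case/andP: d02; lra.
rewrite (le_trans _ y4) ?ler1n // => /(_ isT isT HL).
case.
- by lra.
- move=> x sx.
  have h1 : 0 < b <= 1 by rewrite b0 /b; case/andP: d02; lra.
  have h2 : 0 <= th by rewrite /th /b; move: sg_lt d0; lra.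
  have h3 : 1 - s + th = b by rewrite /th /s; ring.
  have h4 : th <= s by rewrite /th /s /b; move: sg_lt sg_ge0 d0; case/andP: d02; lra.
  have h5 : 1 - s <= b by rewrite /s /b; move: sg_lt sg_ge0 d0; lra.
  apply: le_trans (euler_error_le chiD HL sx (ltnW Y4) YK h1 h2 h3 h4 h5) _.
  rewrite (_ : 2 * (f / V) = f / V + f / V); last by ring.
  by apply: lerD maj (truncation_error q0 qQ).
- move=> w [wL wB]; exists w; split=> //; apply: le_trans wB _.
  rewrite lecR; have := powR_Y_sq; rewrite -/Y; lra.
Qed.

Let moment_le (q : nat) : (0 < q)%N -> (q < N0)%N ->
  q%:R * (10 * Y%:R `^ (2^-1 - s) + 3164 * (q%:R `^ (- (3 / 7)) * K%:R `^ (5 / 56))) <=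
  21 * eta * Q * (f / V).
Proof.
(* an opaque name, since trivial-goal automation is very slow on this literal *)
have [k kE] : exists k : R, k = 3164 by exists 3164.
have k0 : 0 <= k by rewrite kE; lra.
have kc : k * 16 <= c by rewrite kE.
rewrite -kE => q0 qN.
have qQ : q%:R <= Q by move: qN; rewrite ltnS truncn_ge_nat ?(ltW Q0).
have qR : 0 < q%:R :> R by rewrite ltr0n.
have eta0 : 0 <= eta.
  by have := le_trans (powR_ge0 _ _) fa; rewrite pmulr_lge0.
have T1 : q%:R * (10 * Y%:R `^ (2^-1 - s)) <= 20 * eta * Q * (f / V).
  have E : Y%:R `^ (2^-1 - s) <= 2 * (eta * f / V).
    have -> : 2^-1 - s = - (2^-1 - sg) by rewrite /s; field.
    apply: le_trans (powRY _) _; first by move: sg_ge0 sg_lt; case/andP: d02; lra.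
    rewrite ler_wpM2l // opprB powRD_gt0 ?(lt_le_trans _ y4) // powRN.
    rewrite {2}/y -powRrM -/V ler_wpM2r ?invr_ge0 ?(ltW V0) //.
    apply: le_trans fa; rewrite /y -powRrM ler_powR //.
    (* Here A < 14/d turns y^sg = l^(A sg) into the power of log Q that is o(f). *)
    rewrite (_ : 14 * a / (d * l) = 14 / d * sg); last by rewrite /sg; field; rewrite !gt_eqF.
    by rewrite ler_wpM2r // ltW.
  apply: (@le_trans _ _ (Q * (10 * (2 * (eta * f / V))))).
    by apply: ler_pM; rewrite ?ler0n ?mulr_ge0 ?powR_ge0 // ler_wpM2l.
  by rewrite le_eqVlt; apply/orP; left; apply/eqP; field; rewrite gt_eqF.
(* Since K <= 16 Q^4, this is O(Q^(4/7 + 5/14)) = O(Q^(13/14)); the spare Q^(1/14) beats the powers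
   of log Q by [grow2]. *)
have T2 : q%:R * (k * (q%:R `^ (- (3 / 7)) * K%:R `^ (5 / 56))) <= eta * Q * (f / V).
  have K1 : K%:R `^ (5 / 56) <= 16 * Q `^ (5 / 14).
    apply: (@le_trans _ _ ((16 * Q ^+ 4) `^ (5 / 56))).
      rewrite ge0_ler_powR ?nnegrE ?mulr_ge0 ?exprn_ge0 ?ler0n ?(ltW Q0) //.
      rewrite /K natrX (_ : 16 * Q ^+ 4 = (2 * Q) ^+ 4); last by ring.
      by rewrite lerXn2r ?nnegrE ?ler0n ?mulr_ge0 ?(ltW Q0).
    rewrite powRM ?exprn_ge0 ?(ltW Q0) //; apply: ler_pM; rewrite ?powR_ge0 //.
      by rewrite -[leRHS](powRr1 (a := 16)) // ler_powR ?ler1n //; lra.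
    rewrite -powR_mulrn ?(ltW Q0) // -powRrM ler_powR //; lra.
  have q47 : q%:R * q%:R `^ (- (3 / 7)) <= Q `^ (4 / 7).
    rewrite -{1}(powRr1 (ltW qR)) -powRD_gt0 //.
    rewrite (_ : 1 + - (3 / 7) = 4 / 7); last by field.
    by rewrite ge0_ler_powR ?nnegrE ?(ltW qR) ?(ltW Q0).
  have lV : (1 : R) <= l `^ (7 / d) * (f / V).
    have p0 := powR_gt0 (7 / d) l0.
    by have := lam_ge; rewrite powRN -(ler_pM2l p0) mulfV // gt_eqF.
  have c0 : 0 <= c by move: kc k0; lra.
  have QQ : c * (Q `^ (4 / 7) * Q `^ (5 / 14)) <= eta * Q * (f / V).
    rewrite -powRD_gt0 // (_ : 4 / 7 + 5 / 14 = 1 - 1 / 14); last by field.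
    rewrite powRD_gt0 // powRr1 ?(ltW Q0) // mulrCA [leRHS](_ : _ = Q * (eta * (f / V))); last by ring.
    rewrite ler_wpM2l ?(ltW Q0) //.
    have -> : Q `^ (- (1 / 14)) = (expR (l / 14))^-1.
      by rewrite powRN {1}QE -expRM mulrA mulr1.
    rewrite ler_pdivrMr ?expR_gt0 //.
    have fV0 : 0 <= f / V by rewrite divr_ge0 ?ltW.
    apply: (@le_trans _ _ (c * l `^ (7 / d) * (f / V))).
      have := ler_wpM2l c0 lV; rewrite mulr1 => /le_trans; apply.
      by rewrite le_eqVlt; apply/orP; left; apply/eqP; ring.
    apply: le_trans (ler_wpM2r fV0 grow2) _.
    by rewrite le_eqVlt; apply/orP; left; apply/eqP; ring.
  apply: (@le_trans _ _ (k * (Q `^ (4 / 7) * (16 * Q `^ (5 / 14))))).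
    rewrite mulrCA; apply: ler_wpM2l => //; rewrite (mulrA q%:R); apply: ler_pM; last 2 first.
    - exact: q47.
    - exact: K1.
    - by rewrite mulr_ge0 ?powR_ge0 ?ler0n.
    - exact: powR_ge0.
  apply: le_trans QQ; set u := Q `^ (4 / 7); set v := Q `^ (5 / 14).
  have uv0 : 0 <= u * v by rewrite mulr_ge0 ?powR_ge0.
  apply: le_trans (ler_wpM2r uv0 kc).
  by rewrite le_eqVlt; apply/orP; left; apply/eqP; ring.
rewrite mulrDr; lra.
Qed.

(** Markov's inequality for each modulus: an exceptional character has majorant above f/V, while the
    majorants add up to at most 21 eta Q f/V. There are at most 2Q moduli. *)
Lemma exceptional_count (X : seq (nat * (nat -> R[i]))) : uniq X ->
  (forall x, x \in X -> [/\ x.1%:R <= Q, primitive_character x.1 x.2 &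
     ~ log_L_approx x.1 x.2 s y (72 * (f / V))]) ->
  (size X)%:R <= 2 * Q + 42 * eta * Q ^+ 2.
Proof.
move=> uX HX.
have eta0 : 0 <= eta.
  by have := le_trans (powR_ge0 _ _) fa; rewrite pmulr_lge0.
pose Xq q := [seq x.2 | x <- X & x.1 == q].
have uXq q : uniq (Xq q).
  rewrite map_inj_in_uniq ?filter_uniq // => -[u1 u2] [v1 v2].
  by rewrite !mem_filter /= => /andP[/eqP -> _] /andP[/eqP -> _] ->.
have inXq q chi : chi \in Xq q -> (q, chi) \in X.
  by case/mapP => -[u1 u2]; rewrite mem_filter /= => /andP[/eqP -> ?] ->.
have XqD q chi : chi \in Xq q -> dirichlet_character q chi.
  by move=> /inXq/HX[_ []].
have sizeE : size X = (\sum_(q < N0) size (Xq q))%N.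
  under eq_bigr do rewrite size_map size_filter -sum1_count big_mkcond /=.
  rewrite exchange_big /= -sum1_size; apply: eq_big_seq => x xX.
  have [xQ _ _] := HX _ xX.
  have xN : (x.1 < N0)%N by rewrite ltnS truncn_ge_nat ?(ltW Q0).
  rewrite (bigD1 (Ordinal xN)) //= eqxx big1 // => q.
  by rewrite -val_eqE /= eq_sym => /negbTE ->.
have each (q : 'I_N0) : (size (Xq q))%:R <= 1 + 21 * eta * Q :> R.
  have r0 : 0 <= 21 * eta * Q by rewrite !mulr_ge0 // ltW.
  (* Modulus 1 carries the principal character, to which the argument does not apply; it is counted
     as exceptional. *)
  case: (leqP q 1) => q1.
    have : (size (Xq q) <= 1)%N := leq_trans (size_characters (uXq q) (@XqD q)) q1.
    by rewrite -(ler_nat R) => /le_trans; apply; rewrite lerDl.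
  have lam0 : 0 < f / V by rewrite divr_gt0.
  have q0 : (0 < q)%N by apply: ltnW.
  have s14 : 13 / 14 <= s by rewrite /s; move: sg_lt; case/andP: d02; lra.
  have m := rough_majorant_moment (primes_upto Y) (uXq q) (@XqD q) s14
    (leq_trans (isT : 0 < 4)%N Y4) q0 (isT : 0 < K)%N.
  have {}m := le_trans m (moment_le q0 (ltn_ord q)).
  have : (size (Xq q))%:R * (f / V) <= 21 * eta * Q * (f / V).
    apply: le_trans m; rewrite mulr_natl -iter_addr_0 -count_predT -big_const_seq.
    rewrite big_seq_cond [leRHS]big_seq_cond; apply: ler_sum => chi /andP[chiX _].
    have [qQ prim bad] := HX _ (inXq _ _ chiX).
    rewrite leNgt; apply/negP => /ltW maj; apply: bad.
    exact: log_L_approx_good (primitive_nonprincipal prim q1) qQ maj.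
  by rewrite ler_pM2r // => /le_trans; apply; rewrite lerDr.
rewrite sizeE natr_sum.
apply: (@le_trans _ _ (\sum_(q < N0) (1 + 21 * eta * Q))); first exact: ler_sum.
rewrite sumr_const card_ord -[leLHS]mulr_natl.
apply: (@le_trans _ _ (2 * Q * (1 + 21 * eta * Q))).
  by rewrite ler_wpM2r // addr_ge0 // !mulr_ge0 // ltW.
by rewrite le_eqVlt; apply/orP; left; apply/eqP; ring.
Qed.

End SinglePoint.

(** * Letting Q tend to infinity *)


Section Growth.
Variable R : realType.

Lemma near_pinfty_gt (M : R) : \forall x \near +oo, M < x.
Proof. by apply: nbhs_pinfty_gt; rewrite num_real. Qed.

Lemma near_pinfty_ge (M : R) : \forall x \near +oo, M <= x.
Proof. by apply: nbhs_pinfty_ge; rewrite num_real. Qed.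

Lemma near_ln (P : R -> Prop) : (\forall l \near +oo, P l) -> \forall Q \near +oo, P (ln Q).
Proof.
case=> M [_ MP]; apply: filterS (near_pinfty_gt (expR M)) => Q MQ.
apply: MP; rewrite -(expRK M) ltr_ln ?posrE ?expR_gt0 //.
exact: lt_trans (expR_gt0 M) MQ.
Qed.

(** With u = l^(1/8), the logarithm of the left side is at most (C + 8p + B) u^7, against c u^8 on
    the right. *)
Lemma expR_dominates (k p B c : R) : 0 < k -> 0 <= p -> 0 <= B -> 0 < c ->
  \forall l \near +oo, k * l `^ p * expR (B * l `^ (7 / 8)) <= expR (c * l).
Proof.
move=> k0 p0 B0 c0; set C := Num.max 0 (ln k).
have C0 : 0 <= C by rewrite le_max lexx.
have kC : k <= expR C by rewrite -(lnK k0) ler_expR le_max lexx orbT.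
set M := 1 + (C + 8 * p + B) / c.
have M1 : 1 <= M by rewrite lerDl divr_ge0 ?(ltW c0) // !addr_ge0 // mulr_ge0.
apply: filterS2 (near_pinfty_ge 1) (near_pinfty_ge (M `^ 8)) => l l1 lM.
have l0 : 0 < l by apply: lt_le_trans l1.
set u := l `^ (1 / 8).
have uM : M <= u.
  have -> : M = (M `^ 8) `^ (1 / 8).
    by rewrite -powRrM (_ : 8 * (1 / 8) = 1) ?powRr1 ?(le_trans _ M1) //; field.
  by rewrite ge0_ler_powR ?nnegrE ?powR_ge0 ?(ltW l0).
have u1 : 1 <= u by apply: le_trans uM.
have u0 : 0 < u by apply: lt_le_trans u1.
have l7 : l `^ (7 / 8) = u ^+ 7.
  by rewrite -powR_mulrn ?(ltW u0) // /u -powRrM; congr (_ `^ _); field.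
have l8 : l = u * u ^+ 7.
  rewrite -exprS -powR_mulrn ?(ltW u0) // /u -powRrM.
  by rewrite (_ : 1 / 8 * 8%:R = 1) ?powRr1 ?(ltW l0) //; field.
have lnl : ln l <= 8 * u ^+ 7.
  rewrite (_ : ln l = 8 * ln u); last by rewrite /u ln_powR; field.
  rewrite ler_wpM2l //; apply: le_trans (ltW (ln_sublinear u0)) _.
  by rewrite -[leLHS]expr1 ler_weXn2l.
have u7 : 1 <= u ^+ 7 by rewrite exprn_ege1.
have -> : l `^ p = expR (p * ln l) by rewrite /powR gt_eqF.
apply: (@le_trans _ _ (expR C * expR (p * ln l) * expR (B * l `^ (7 / 8)))).
  by rewrite ler_wpM2r ?expR_ge0 // ler_wpM2r ?expR_ge0.
rewrite -!expRD ler_expR l7.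
have h1 : p * ln l <= p * (8 * u ^+ 7) by rewrite ler_wpM2l.
have h2 : C <= C * u ^+ 7 by rewrite ler_peMr.
have h3 : C + 8 * p + B <= c * u.
  have : (C + 8 * p + B) / c <= u by apply: le_trans uM; rewrite /M lerDr.
  by rewrite ler_pdivrMr // (mulrC u).
have u70 : 0 <= u ^+ 7 by apply: le_trans u7.
have := ler_wpM2r u70 h3; rewrite {2}l8 mulrA; lra.
Qed.

End Growth.

Lemma log_L_approxW (R : realType) q (chi : nat -> R[i]) (s y B B' : R) :
  B <= B' -> log_L_approx q chi s y B -> log_L_approx q chi s y B'.
Proof.
move=> BB' [w [wL wB]]; exists w; split=> //; apply: le_trans wB _.
by rewrite lecR.
Qed.

Lemma almost_all_log_L_approx (R : realType) (d : R) (a A f : R -> R) : 0 < d < 2 ->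
  (\forall Q \near +oo, 0 <= 28 * a Q < d * ln Q) ->
  (\forall Q \near +oo, 28 * a Q / (d * ln Q) < A Q < 14 / d) ->
  f Q @[Q --> +oo] --> +oo ->
  (fun Q => ln Q `^ (14 * a Q / (d * ln Q))) =o_+oo f ->
  f =o_+oo (fun Q => ln Q `^ (A Q / 2)) ->
  almost_all_primitive (fun Q q chi =>
    log_L_approx q chi (1 - a Q / ln Q) (ln Q `^ A Q)
      (72 * (expR (a Q) * ln (ln Q) / ln Q + f Q / ln Q `^ (A Q / 2)))).
Proof.
move=> d02 aH AH foo /eqoP fa /eqoP fV eps eps0.
have d0 : 0 < d by case/andP: d02.
(* So 42 eta = eps/2; the other half of eps absorbs 2Q once Q >= 4/eps. *)
pose eta := eps / 84; have eta0 : 0 < eta by rewrite divr_gt0.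
(* an opaque name, since trivial-goal automation is very slow on this literal *)
have [k kE] : exists k : R, k = 3164 * 16 by exists (3164 * 16).
have k0 : 0 < k by rewrite kE; lra.
have b0 : 0 < d / 16 by rewrite divr_gt0.
have c20 : 0 < 2 + 2 / (d / 16) by rewrite addr_gt0 // divr_gt0.
have g1 := near_ln (@expR_dominates R (2 + 2 / (d / 16)) (7 / d) (2 / (d / 16)) (d / 56) c20
  (divr_ge0 (ler0n _ 7) (ltW d0)) (divr_ge0 (ler0n _ 2) (ltW b0)) (divr_gt0 d0 (ltr0Sn _ 55))).
have g2 := near_ln (@expR_dominates R (k / eta) (7 / d) 0 14^-1 (divr_gt0 k0 eta0)
  (divr_ge0 (ler0n _ 7) (ltW d0)) (lexx 0) (ltac:(by rewrite invr_gt0))).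
have l1 := near_ln (near_pinfty_ge (1 : R)).
have f1 : \forall Q \near +oo, 1 <= f Q by move/cvgryPge : foo; apply.
have fa' := fa _ eta0.
have e4 : 0 < 4^-1 :> R by rewrite invr_gt0.
have fV' := fV _ e4.
near=> Q.
have lQ : 1 <= ln Q by near: Q.
have fQ : 1 <= f Q by near: Q.
have Q1 : 1 <= Q by near: Q; apply: near_pinfty_ge.
have Q4 : 4 / eps <= Q by near: Q; apply: near_pinfty_ge.
have aQ : 0 <= 28 * a Q < d * ln Q by near: Q.
have AQ : 28 * a Q / (d * ln Q) < A Q < 14 / d by near: Q.
have fVQ : 4 * f Q <= ln Q `^ (A Q / 2).
  have : `|f Q| <= 4^-1 * `|ln Q `^ (A Q / 2)| by near: Q.
  by rewrite !ger0_norm ?powR_ge0 ?(le_trans _ fQ) //; lra.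
have faQ : ln Q `^ (14 * a Q / (d * ln Q)) <= eta * f Q.
  have : `|ln Q `^ (14 * a Q / (d * ln Q))| <= eta * `|f Q| by near: Q.
  by rewrite !ger0_norm ?powR_ge0 ?(le_trans _ fQ).
have g1Q : (2 + 2 / (d / 16)) * ln Q `^ (7 / d) * expR (2 / (d / 16) * ln Q `^ (7 / 8)) <=
    expR (d / 56 * ln Q) by near: Q.
have g2Q : k * ln Q `^ (7 / d) <= eta * expR (ln Q / 14).
  have : k / eta * ln Q `^ (7 / d) * expR (0 * ln Q `^ (7 / 8)) <= expR (14^-1 * ln Q) by near: Q.
  rewrite mul0r expR0 mulr1 (mulrC 14^-1) => /(ler_wpM2l (ltW eta0)); apply: le_trans.
  by rewrite le_eqVlt; apply/orP; left; apply/eqP; field; rewrite gt_eqF.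
have V2 : 2 <= ln Q `^ (A Q / 2) by lra.
have epsQ : 0 <= eps * Q ^+ 2 by rewrite mulr_ge0 ?exprn_ge0 ?(ltW eps0) ?(le_trans _ Q1).
exists (Num.truncn (eps * Q ^+ 2)); first by rewrite truncn_le.
apply: card_leI_uniq => X uX HX; rewrite truncn_ge_nat //.
apply: (@le_trans _ _ (2 * Q + 42 * eta * Q ^+ 2)); last first.
  have : 4 <= eps * Q by move: Q4; rewrite ler_pdivrMr // mulrC.
  by rewrite /eta; nra.
have kk : 3164 * 16 <= k by rewrite kE.
apply: (@exceptional_count R d Q (a Q) (A Q) (f Q) eta k d02 lQ Q1 aQ AQ V2 fQ fVQ faQ g1Q kk g2Q) => // x /HX.
case=> xQ prim bad; split=> // good; apply: bad; apply: log_L_approxW good.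
rewrite ler_wpM2l // lerDr mulr_ge0 ?invr_ge0 ?(le_trans _ lQ) // mulr_ge0 ?expR_ge0 //.
exact: ln_ge0.
Unshelve. all: by end_near.
Qed.

Theorem theorem5 (R : realType) (delta : R) (hdelta : 0 < delta < 2) :
  exists2 K : R, 0 < K &
    (forall a A f : R -> R,
      (\forall Q \near +oo, 0 <= 28 * a Q < delta * ln Q) ->
      (\forall Q \near +oo,
         28 * a Q / (delta * ln Q) < A Q < 14 / delta) ->
      f Q @[Q --> +oo] --> +oo ->
      (fun Q => ln Q `^ (14 * a Q / (delta * ln Q))) =o_+oo f ->
      f =o_+oo (fun Q => ln Q `^ (A Q / 2)) ->
      almost_all_primitive (fun Q q chi =>
        log_L_approx q chi (1 - a Q / ln Q) (ln Q `^ A Q)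
          (K * (expR (a Q) * ln (ln Q) / ln Q + f Q / ln Q `^ (A Q / 2)))))
    /\
    (forall A f : R -> R,
      (\forall Q \near +oo, 0 < A Q < 14 / delta) ->
      f Q @[Q --> +oo] --> +oo ->
      f =o_+oo (fun Q => ln Q `^ (A Q / 2)) ->
      almost_all_primitive (fun Q q chi =>
        log_L_approx q chi 1 (ln Q `^ A Q)
          (K * (expR 0 * ln (ln Q) / ln Q + f Q / ln Q `^ (A Q / 2))))).
Proof.
have d0 : 0 < delta by case/andP: hdelta.
exists 72; first by rewrite ltr0n.
split=> [a A f|A f AH foo fV]; first exact: almost_all_log_L_approx.
have [a a0] : exists a : R -> R, forall Q, a Q = 0 by exists (fun=> 0).
have aH : \forall Q \near +oo, 0 <= 28 * a Q < delta * ln Q.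
  apply: filterS (near_ln (near_pinfty_gt (0 : R))) => Q lQ.
  by rewrite a0 mulr0 lexx mulr_gt0.
have AH' : \forall Q \near +oo, 28 * a Q / (delta * ln Q) < A Q < 14 / delta.
  by apply: filterS AH => Q; rewrite a0 mulr0 mul0r.
(* For a = 0 the power is 1, which is o(f) because f tends to infinity. *)
have fa : (fun Q => ln Q `^ (14 * a Q / (delta * ln Q))) =o_+oo f.
  apply/eqoP => e e0.
  have : \forall Q \near +oo, e^-1 <= f Q by move/cvgryPge : foo; apply.
  apply: filterS => Q fQ; rewrite a0 mulr0 mul0r powRr0 normr1.
  by rewrite -ler_pdivrMl // mulr1; apply: le_trans fQ _; apply: ler_norm.
move=> eps eps0.
apply: filterS (almost_all_log_L_approx hdelta aH AH' foo fa fV eps0) => Q [N NQ XN].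
by exists N => //; move: XN; rewrite a0 mul0r subr0.
Qed.
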